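(* Let $M$ be an ordered matroid on $E$ with maximum base $T$ (the maximum element of $L(M)$), and let $r^*=\mathrm{rk}(M^*|T)$. Then $$\tilde H_i(\Delta(M))\cong\begin{cases}\mathbb Z^{\tilde\mu(M.T)} & \text{if } i=r^*-1,\\ 0 & \text{otherwise.}\end{cases}$$
   Context: An ordered matroid is a matroid on a finite set $E$ together with a linear order on $E$. For $F\subseteq E$, $e\in E$ is active with respect to $F$ if there is a circuit $C\subseteq F\cup\{e\}$ with $e\in C$ and $e$ the minimum of $C$; $\mathrm{Act}_M(F)$ is the set of such $e$ (possibly $e\in F$), and $\mathrm{Ext}_M(F)=\mathrm{Act}_M(F)\setminus F$. The external order on bases: $A\le B$ iff $A\subseteq B\cup\mathrm{Ext}_M(B)$; $L(M)$ is the set of bases with this order and a new minimum $\hat0$ adjoined (a lattice), with maximum element $T=E\setminus\mathrm{Act}_M(E)$. $\Delta(M)$ is the order complex of $L(M)$ (simplicial complex on $L(M)\setminus\{\hat0,T\}$ whose faces are nonempty chains); $\tilde H_i$ is reduced homology with $\mathbb Z$ coefficients. $M^*$ is the dual matroid and $M^*|T$ its restriction to $T$. $M.T$ is the contraction of $M$ to $T$ (i.e. $M/(E\setminus T)$), so $(M^*|T)^*=M.T$. For a matroid $N$ with lattice of flats $L_F(N)$, the reduced Möbius function is $\tilde\mu(N)=|\mu(L_F(N))|$ (Möbius function from bottom to top of $L_F(N)$) if $N$ is loopless, and $\tilde\mu(N)=0$ otherwise. *)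

(* Defs.v *)
From HB Require Import structures.
From mathcomp Require Import all_boot all_order all_algebra.
From mathcomp Require Import boolp zify.

Set Implicit Arguments.
Unset Strict Implicit.
Unset Printing Implicit Defensive.

Import Order.TTheory GRing.Theory Num.Theory.

Local Open Scope ring_scope.

(* The ground set is a subset of an ambient finite type, so that restrictions
   and contractions live over the same type as the matroid itself. *)
Record matroid (E : finType) := Matroid {
  ground : {set E};
  indep : {set {set E}};
  indep_ground : forall I, I \in indep -> I \subset ground;
  indep0 : set0 \in indep;
  indepS : forall I J : {set E}, I \subset J -> J \in indep -> I \in indep;
  indep_aug : forall I J, I \in indep -> J \in indep -> (#|I| < #|J|)%N ->
    exists2 x, x \in J :\: I & x |: I \in indep
}.

Section MatroidNotions.
Variable E : finType.
Implicit Types (M : matroid E) (A B F I J X Y : {set E}) (e : E).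

Definition bases M : {set {set E}} :=
  [set B | maxset [pred I | I \in indep M] B].

Definition circuits M : {set {set E}} :=
  [set C : {set E} |
    minset [pred X : {set E} | (X \subset ground M) && (X \notin indep M)] C].

Definition rk M F : nat := \max_(I in indep M | I \subset F) #|I|.

Definition mrank M : nat := rk M (ground M).

Definition loopless M : bool :=
  [forall e, (e \in ground M) ==> ([set e] \notin circuits M)].

Definition mclosure M F : {set E} :=
  [set e in ground M | rk M (e |: F) == rk M F].

Definition flats M : {set {set E}} :=
  [set F : {set E} | (F \subset ground M) && (mclosure M F == F)].

Lemma indep_maxset M I X : I \in indep M -> I \subset X ->
  exists J, [/\ J \in indep M, I \subset J, J \subset X
    & forall K : {set E}, K \in indep M -> K \subset X -> (#|K| <= #|J|)%N].
Proof.
move=> Ii IX.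
have [J /maxsetP[/= /andP[Ji JX] maxJ] IJ] :
    {J | maxset [pred K | (K \in indep M) && (K \subset X)] J & I \subset J}.
  by apply: maxset_exists; rewrite /= Ii.
exists J; split=> // K Ki KX; rewrite leqNgt; apply/negP=> ltJK.
have [x] := indep_aug Ji Ki ltJK.
rewrite inE => /andP[xJ xK] xJi.
have eJ : x |: J = J.
  by apply: maxJ; rewrite /= ?subsetUr // xJi subUset sub1set JX (subsetP KX).
by case/negP: xJ; rewrite -eJ setU11.
Qed.

Lemma basesP M B : reflect
  (B \in indep M /\ forall I, I \in indep M -> (#|I| <= #|B|)%N)
  (B \in bases M).
Proof.
rewrite inE; apply: (iffP maxsetP) => -[/= Bi maxB]; split=> //.
  have [J [Ji BJ _ maxJ]] := indep_maxset Bi (subsetT B).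
  by move=> I Ii; rewrite -(maxB J Ji BJ) maxJ ?subsetT.
by move=> I /= Ii BI; apply/esym/eqP; rewrite eqEcard BI maxB.
Qed.

Lemma bases_ext M I B : I \in indep M -> B \in bases M ->
  exists B', [/\ B' \in bases M, I \subset B' & B' \subset I :|: B].
Proof.
move=> Ii /basesP[Bi maxB].
have [J [Ji IJ JIB maxJ]] := indep_maxset Ii (subsetUl I B).
exists J; split=> //; apply/basesP; split=> // K Ki.
by apply: leq_trans (maxB K Ki) _; apply: maxJ; rewrite ?subsetUr.
Qed.

Lemma bases_exists M : exists B, B \in bases M.
Proof.
have [J [Ji _ _ maxJ]] := indep_maxset (indep0 M) (sub0set setT).
by exists J; apply/basesP; split=> // I Ii; apply: maxJ; rewrite ?subsetT.
Qed.

Section Restriction.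
Variables (M : matroid E) (X : {set E}).

Definition restrict_indep := [set I in indep M | I \subset X].

Lemma restrict_ground I :
  I \in restrict_indep -> I \subset ground M :&: X.
Proof. by rewrite inE subsetI => /andP[/indep_ground-> ->]. Qed.

Lemma restrict0 : set0 \in restrict_indep.
Proof. by rewrite inE indep0 sub0set. Qed.

Lemma restrictS I J :
  I \subset J -> J \in restrict_indep -> I \in restrict_indep.
Proof.
move=> IJ; rewrite !inE => /andP[Ji JX].
by rewrite (indepS IJ Ji) (subset_trans IJ JX).
Qed.

Lemma restrict_aug I J : I \in restrict_indep -> J \in restrict_indep ->
  (#|I| < #|J|)%N -> exists2 x, x \in J :\: I & x |: I \in restrict_indep.
Proof.
rewrite !inE => /andP[Ii IX] /andP[Ji JX] ltIJ.
have [x xJI xIi] := indep_aug Ii Ji ltIJ; exists x => //.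
by move: xJI; rewrite !inE xIi subUset sub1set IX => /andP[_ /(subsetP JX)->].
Qed.

Definition restrict : matroid E :=
  Matroid restrict_ground restrict0 restrictS restrict_aug.

End Restriction.

Section Dual.
Variable M : matroid E.

Definition dual_indep : {set {set E}} :=
  [set I : {set E} |
    (I \subset ground M) && [exists B in bases M, [disjoint I & B]]].

Lemma dual_ground I : I \in dual_indep -> I \subset ground M.
Proof. by rewrite inE => /andP[]. Qed.

Lemma dual0 : set0 \in dual_indep.
Proof.
rewrite inE sub0set; have [B Bb] := bases_exists M.
by apply/existsP; exists B; rewrite Bb -setI_eq0 set0I eqxx.
Qed.

Lemma dualS I J : I \subset J -> J \in dual_indep -> I \in dual_indep.
Proof.
move=> IJ; rewrite !inE => /andP[JE /existsP[B /andP[Bb JB]]].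
rewrite (subset_trans IJ JE); apply/existsP; exists B.
by rewrite Bb (disjointWl IJ JB).
Qed.

Lemma dual_aug I J : I \in dual_indep -> J \in dual_indep ->
  (#|I| < #|J|)%N -> exists2 x, x \in J :\: I & x |: I \in dual_indep.
Proof.
rewrite !inE => /andP[IE /existsP[B /andP[Bb IB]]].
move=> /andP[JE /existsP[B' /andP[B'b JB']]] ltIJ.
have [B'i maxB'] := basesP _ _ B'b.
have [B2 [B2b sB2 B2s]] :=
  bases_ext (indepS (subsetDl B' I) B'i) Bb.
have IB2 : [disjoint I & B2].
  apply: disjointWr B2s _; rewrite -setI_eq0 setIUr setU_eq0 !setI_eq0 IB andbT.
  by rewrite disjoint_sym disjoints_subset subsetDr.
have [sJB2|] := boolP (J :\: I \subset B2); last first.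
  case/subsetPn=> x xJI xB2; exists x => //.
  move: xJI; rewrite !inE => /andP[xI xJ].
  rewrite subUset sub1set IE (subsetP JE) //=; apply/existsP; exists B2.
  rewrite B2b -setI_eq0 setIUl setU_eq0 !setI_eq0 IB2 andbT.
  by rewrite disjoints1.
have [B2i _] := basesP _ _ B2b.
have := maxB' _ B2i; rewrite leqNgt; case/negP.
have cardU (A C : {set E}) : [disjoint A & C] -> #|A :|: C| = (#|A| + #|C|)%N.
  by move=> dAC; rewrite -cardsUI disjoint_setI0 // cards0 addn0.
have le1 : (#|B' :\: I| + #|J :\: I| <= #|B2|)%N.
  rewrite -cardU; first by rewrite subset_leq_card // subUset sB2.
  apply: disjointWl (subsetDl _ _) _; apply: disjointWr (subsetDl _ _) _.
  by rewrite disjoint_sym.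
have le2 : (#|B' :&: I| + #|J :&: I| <= #|I|)%N.
  rewrite -cardU; first by rewrite subset_leq_card // subUset !subsetIr.
  apply: disjointWl (subsetIl _ _) _; apply: disjointWr (subsetIl _ _) _.
  by rewrite disjoint_sym.
have := cardsID I B'; have := cardsID I J; move: le1 le2 ltIJ; lia.
Qed.

Definition dual : matroid E := Matroid dual_ground dual0 dualS dual_aug.

End Dual.

Section Contraction.
Variables (M : matroid E) (X : {set E}).

Definition contract_indep : {set {set E}} :=
  [set I : {set E} | (I \subset ground M :\: X) &&
    [exists Y in bases (restrict M X), I :|: Y \in indep M]].

Lemma contract_ground I : I \in contract_indep -> I \subset ground M :\: X.
Proof. by rewrite inE => /andP[]. Qed.

Lemma contract0 : set0 \in contract_indep.
Proof.
rewrite inE sub0set; have [Y Yb] := bases_exists (restrict M X).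
apply/existsP; exists Y; rewrite Yb set0U.
by case/basesP: Yb; rewrite /= inE => /andP[].
Qed.

Lemma contractS I J :
  I \subset J -> J \in contract_indep -> I \in contract_indep.
Proof.
move=> IJ; rewrite !inE => /andP[JE /existsP[Y /andP[Yb JYi]]].
rewrite (subset_trans IJ JE); apply/existsP; exists Y.
by rewrite Yb (indepS (setSU Y IJ) JYi).
Qed.

Lemma contract_aug I J : I \in contract_indep -> J \in contract_indep ->
  (#|I| < #|J|)%N -> exists2 x, x \in J :\: I & x |: I \in contract_indep.
Proof.
rewrite !inE => /andP[IE /existsP[Y /andP[Yb IYi]]].
move=> /andP[JE /existsP[Z /andP[Zb JZi]]] ltIJ.
have [Yi maxY] := basesP _ _ Yb; have [Zi maxZ] := basesP _ _ Zb.
have [/setIdP[_ YX] /setIdP[_ ZX]] := (Yi, Zi).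
have cardU (A C : {set E}) :
    A \subset ground M :\: X -> C \subset X -> #|A :|: C| = (#|A| + #|C|)%N.
  move=> AE CX; rewrite -cardsUI disjoint_setI0 ?cards0 ?addn0 //.
  apply: disjointWr CX _; apply: disjointWl AE _.
  by rewrite disjoint_sym disjoints_subset setCD subsetUr.
have ltIJ' : (#|I :|: Y| < #|J :|: Z|)%N.
  rewrite !cardU // (_ : #|Y| = #|Z|) ?ltn_add2r //.
  by apply/eqP; rewrite eqn_leq maxY ?maxZ.
have [x] := indep_aug IYi JZi ltIJ'.
rewrite !inE negb_or => /andP[/andP[xI xY] xJZ] xIYi.
have [xZ|xZ] := boolP (x \in Z).
  have : x |: Y \in indep (restrict M X).
    rewrite inE subUset sub1set YX (subsetP ZX) // !andbT.
    by apply: (indepS _ xIYi); rewrite setUS // subsetUr.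
  by move/maxY; rewrite cardsU1 xY ltnn.
have xJ : x \in J by move: xJZ; rewrite (negPf xZ) orbF.
exists x; first by rewrite inE xI.
rewrite inE subUset sub1set (subsetP JE) // IE; apply/existsP; exists Y.
by rewrite Yb -setUA.
Qed.

Definition contract : matroid E :=
  Matroid contract_ground contract0 contractS contract_aug.

End Contraction.

(* Tutte's M.T: the elements outside [T] are contracted. *)
Definition contract_to M T : matroid E := contract M (ground M :\: T).

End MatroidNotions.

Section Mobius.
Variables (V : finType) (P : {set V}) (le : rel V).

(* Recursion on fuel; [mobiusE] shows that #|P| is enough fuel for a poset. *)
Fixpoint mobius_rec (n : nat) (x y : V) : int :=
  if n is n'.+1 then
    if x == y then 1
    else - \sum_(z in P | [&& le x z, le z y & z != y]) mobius_rec n' x z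
  else 0.

Definition mobius : V -> V -> int := mobius_rec #|P|.

Lemma mobius_rec_fuel n m x y :
  reflexive le -> antisymmetric le -> transitive le -> y \in P ->
  (#|[set z in P | le x z && le z y]| <= n)%N -> (n <= m)%N ->
  mobius_rec m x y = mobius_rec n x y.
Proof.
move=> lexx anti trans; elim: n m y => [|n IHn] [|m] y yP //=.
- rewrite leqn0 cards_eq0 => /eqP I0 _.
  have nle z : z \in P -> le x z -> le z y -> False.
    by move=> zP xz zy; have := in_set0 z; rewrite -I0 inE zP xz zy.
  case: eqP => [xy|_]; first by case: (nle y); rewrite ?xy.
  rewrite big_pred0 ?oppr0 // => z; apply/negP => /and4P[zP xz zy _].
  exact: (nle z).
- move=> leIn lenm; case: eqP => // _; congr (- _).
  apply: eq_bigr => z /and4P[zP xz zy nzy]; apply: IHn => //.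
  rewrite -ltnS; apply: leq_trans leIn; apply: proper_card.
  apply/properP; split.
    apply/subsetP => u; rewrite !inE => /and3P[-> -> uz].
    exact: trans uz zy.
  exists y; first by rewrite !inE yP lexx andbT (trans _ _ _ xz zy).
  rewrite !inE yP /=; apply: contra nzy => /andP[_ yz].
  by apply/eqP/anti; rewrite zy yz.
Qed.

Lemma mobiusE x y :
  reflexive le -> antisymmetric le -> transitive le -> y \in P ->
  mobius x y = if x == y then 1
    else - \sum_(z in P | [&& le x z, le z y & z != y]) mobius x z.
Proof.
move=> lexx anti trans yP.
rewrite /mobius -(@mobius_rec_fuel _ #|P|.+1) //; last first.
  by rewrite subset_leq_card // setIdE subsetIl.
Qed.

End Mobius.

Definition reduced_mobius (E : finType) (N : matroid E) : nat :=
  if loopless N then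
    absz (mobius (flats N) (fun F G : {set E} => F \subset G)
            (mclosure N set0) (ground N))
  else 0%N.

Definition order_complex (V : finType) (P : {set V}) (le : rel V) :
    {set {set V}} :=
  [set S : {set V} | [&& S \subset P, S != set0 &
    [forall x in S, forall y in S, le x y || le y x]]].

Section ReducedHomology.
Variable V : finType.

(* The complex is given by its set of nonempty faces. Its [i]-chains are the
   integer functions supported on faces of size [i + 1], where the empty set
   is adjoined as the only face of dimension -1 (augmentation). *)
Definition chain := {ffun {set V} -> int}.

Definition chains (K : {set {set V}}) (i : int) : {pred chain} :=
  fun c => [forall S : {set V}, (c S != 0) ==> (S \in set0 |: K) && (#|S|%:Z == i + 1)].

(* Simplices are oriented by the enumeration order of the vertex type. *)
Definition vertex_pos (S : {set V}) (v : V) : nat :=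
  #|[set u in S | (enum_rank u < enum_rank v)%N]|.

Definition boundary (c : chain) : chain :=
  [ffun R : {set V} => \sum_(S : {set V})
     \sum_(v in S | S :\ v == R) (-1) ^+ vertex_pos S v * c S].

Lemma boundary_is_zmod_morphism : zmod_morphism boundary.
Proof.
move=> c d; apply/ffunP => R; rewrite !ffunE -sumrB; apply: eq_bigr => S _.
by rewrite -sumrB; apply: eq_bigr => v _; rewrite !ffunE mulrBr.
Qed.

HB.instance Definition _ :=
  GRing.isZmodMorphism.Build chain chain boundary boundary_is_zmod_morphism.

Lemma chains_zmod_closed K i : zmod_closed (chains K i).
Proof.
split; first by apply/forallP => S; rewrite ffunE eqxx.
move=> c d /forallP cK /forallP dK; apply/forallP => S; rewrite !ffunE.
apply/implyP; have := cK S; have := dK S.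
by case: (c S =P 0) => [->|_] //=; case: (d S =P 0) => [->|_] //=; rewrite subr0 eqxx.
Qed.

Section Degree.
Variables (K : {set {set V}}) (i : int).

Definition cycles : {pred chain} :=
  fun c => (c \in chains K i) && (boundary c == 0).

Lemma cycles_zmod_closed : zmod_closed cycles.
Proof.
have [c0 cB] := chains_zmod_closed K i.
split; first by rewrite unfold_in c0 raddf0 eqxx.
move=> c d /andP[cK /eqP bc] /andP[dK /eqP bd].
by rewrite unfold_in cB // raddfB /= bc bd subr0 eqxx.
Qed.

HB.instance Definition _ :=
  GRing.isZmodClosed.Build chain cycles cycles_zmod_closed.

Definition cycle_group := {c : chain | c \in cycles}.

HB.instance Definition _ := SubChoice.on cycle_group.
HB.instance Definition _ :=
  [SubChoice_isSubZmodule of cycle_group by <:].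

Definition boundaries : {pred cycle_group} :=
  fun c => `[< exists2 d, d \in chains K (i + 1) & \val c = boundary d >].

Lemma boundaries_zmod_closed : zmod_closed boundaries.
Proof.
have [c0 cB] := chains_zmod_closed K (i + 1).
split; first by apply/asboolP; exists 0; rewrite ?raddf0.
move=> c d /asboolP[c' cK ec] /asboolP[d' dK ed]; apply/asboolP.
by exists (c' - d'); rewrite ?cB // !raddfB /= ec ed.
Qed.

HB.instance Definition _ :=
  GRing.isZmodClosed.Build cycle_group boundaries boundaries_zmod_closed.

Definition reduced_homology : zmodType := Quotient.quot boundaries.

End Degree.
End ReducedHomology.

Definition zmod_isomorphic (U W : zmodType) : Prop :=
  exists f : {additive U -> W}, bijective f.

Section ExternalOrder.
Variables (disp : Order.disp_t) (E : finOrderType disp).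
Implicit Types (M : matroid E) (A B C F T X : {set E}) (e : E).

Definition active M F e : bool :=
  [exists C in circuits M,
    [&& C \subset e |: F, e \in C & [forall f in C, (e <= f)%O]]].

Definition Act M F : {set E} := [set e | active M F e].

Definition Ext M F : {set E} := Act M F :\: F.

(* [None] is the adjoined minimum. *)
Definition ext_lattice M : {set option {set E}} :=
  None |: [set Some B | B in bases M].

Definition ext_le M : rel (option {set E}) := fun x y =>
  match x, y with
  | None, _ => true
  | Some _, None => false
  | Some A, Some B => A \subset B :|: Ext M B
  end.

Definition max_base M T : Prop :=
  Some T \in ext_lattice M /\ {in ext_lattice M, forall x, ext_le M x (Some T)}.

Definition Delta M T : {set {set option {set E}}} :=
  order_complex (ext_lattice M :\: [set None; Some T]) (ext_le M).

Lemma circuit_exists M X : X \subset ground M -> X \notin indep M ->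
  exists2 C, C \in circuits M & C \subset X.
Proof.
move=> XE Xd.
have [|C Cm CX] := @minset_exists _
  [pred X : {set E} | (X \subset ground M) && (X \notin indep M)] X.
  by rewrite /= XE.
by exists C; rewrite ?inE.
Qed.

Lemma Act_ground M F e : e \in Act M F -> e \in ground M.
Proof.
rewrite inE => /existsP[C /and4P[]].
by rewrite inE => /minsetp/andP[/subsetP CE _] _ /CE.
Qed.

Lemma ground_Act_indep M : ground M :\: Act M (ground M) \in indep M.
Proof.
apply: contraT => /(circuit_exists (subsetDl _ _))[C Cc CT].
have /minsetp/andP[CE Cd] : minset [pred X : {set E} |
    (X \subset ground M) && (X \notin indep M)] C by rewrite inE in Cc.
have [C0|[c cC]] := set_0Vmem C; first by rewrite C0 indep0 in Cd.
case: (@Order.TotalTheory.arg_minP _ _ _ c (fun x => x \in C) id cC) => m mC minm.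
have /setDP[_ /negP[]] := subsetP CT m mC.
rewrite inE; apply/existsP; exists C; rewrite Cc mC subsetU ?CE ?orbT //=.
by apply/forall_inP.
Qed.

Lemma Act_dep M e : e \in Act M (ground M) ->
  e |: [set t in ground M :\: Act M (ground M) | (e < t)%O] \notin indep M.
Proof.
set T := ground M :\: _.
have [n] := ubnP #|[set x | (e < x)%O]|; elim: n e => // n IHn e ltn eA.
apply/negP => Ti.
have [C /and4P[Cc CE eC /forall_inP minC]] : exists C, [&& C \in circuits M,
    C \subset e |: ground M, e \in C & [forall f in C, (e <= f)%O]].
  by move: eA; rewrite inE => /existsP.
move: Cc; rewrite inE => /minsetP[/= /andP[CM Cd] Cmin].
set Te := [set t in T | (e < t)%O] in Ti.
have eTe : e \notin Te by rewrite inE ltxx andbF.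
have CDi : C :\ e \in indep M.
  apply: contraT => CDd; have := Cmin (C :\ e).
  rewrite /= (subset_trans (subsetDl _ _) CM) CDd subsetDl => /(_ isT isT).
  by move/setP/(_ e); rewrite !inE eqxx eC.
have [J [Ji CJ JX maxJ]] := indep_maxset CDi (subsetUr Te (C :\ e)).
have leJ : (#|J| <= #|Te|)%N.
  rewrite leqNgt; apply/negP => ltTJ.
  have [x /setDP[xJ xTe] xTi] := indep_aug (indepS (subsetUr _ _) Ti) Ji ltTJ.
  have := subsetP JX x xJ; rewrite inE (negPf xTe) /= => /setD1P[xe xC].
  have ex : (e < x)%O by rewrite lt_neqAle eq_sym xe minC.
  have xE := subsetP CM x xC.
  have xA : x \in Act M (ground M).
    by apply: contraR xTe => xA; rewrite inE ex inE xA xE.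
  have /negP[] : x |: [set t in T | (x < t)%O] \notin indep M.
    apply: IHn xA; apply: leq_trans (_ : _ < #|[set y | (e < y)%O]|)%N ltn.
    apply: proper_card; apply/properP; split.
      by apply/subsetP => y; rewrite !inE; apply: lt_trans.
    by exists x; rewrite !inE ?ltxx.
  apply: (indepS _ xTi); apply: setUS; apply/subsetP => y.
  by rewrite !inE => /andP[->] /(lt_trans ex)->.
have [|x] := indep_aug Ji Ti; first by rewrite cardsU1 eTe.
rewrite inE => /andP[xJ xTe] xJi.
have [xX|xX] := boolP (x \in Te :|: C :\ e).
  have := maxJ _ xJi; rewrite subUset sub1set xX JX cardsU1 xJ ltnn.
  by move/(_ isT).
have xe : x = e.
  by apply/eqP; move: xTe xX; rewrite !inE; case: (x == e) => //= ->.
by case/negP: Cd; apply: (indepS _ xJi); rewrite xe -(setD1K eC) setUS.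
Qed.

Lemma max_base_exists M : max_base M (ground M :\: Act M (ground M)).
Proof.
set T := ground M :\: _; have Ti : T \in indep M := ground_Act_indep M.
have Tdep e : e \in ground M -> e \notin T ->
    e |: [set t in T | (e < t)%O] \notin indep M.
  by move=> eE; rewrite inE eE andbT negbK; apply: Act_dep.
have sT e : [set t in T | (e < t)%O] \subset T by rewrite setIdE subsetIl.
split.
  rewrite !inE /=; apply/imsetP; exists T => //; apply/basesP; split=> // I Ii.
  rewrite leqNgt; apply/negP => /(indep_aug Ti Ii)[x /setDP[xI xT] xTi].
  have /negP[] := Tdep x (subsetP (indep_ground Ii) x xI) xT.
  by apply: (indepS _ xTi); rewrite setUS.
move=> [A|] //=; rewrite !inE /= => /imsetP[B /basesP[Bi _] [->]].
apply/subsetP => e /(subsetP (indep_ground Bi)) eE.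
apply/setUP; have [eT|eT] := boolP (e \in T); [by left|right].
apply/setDP; split=> //; rewrite inE.
have [|C Cc CeT] := circuit_exists _ (Tdep e eE eT).
  by rewrite subUset sub1set eE (subset_trans (sT e)) // subsetDl.
have eC : e \in C.
  apply: contraT => eC; have /minsetp/andP[_ /negP[]] :
    minset [pred X : {set E} | (X \subset ground M) && (X \notin indep M)] C.
    by rewrite inE in Cc.
  apply: indepS Ti; apply/subsetP => x xC; have := subsetP CeT x xC.
  by case/setU1P=> [xe|/(subsetP (sT e))//]; rewrite xe in xC; rewrite xC in eC.
apply/existsP; exists C; rewrite Cc eC (subset_trans CeT (setUS _ (sT e))) /=.
apply/forall_inP => f /(subsetP CeT)/setU1P[->//|].
by rewrite inE => /andP[_ /ltW].
Qed.

End ExternalOrder.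

(* Main.v *)
Require Import Defs.
From HB Require Import structures.
From mathcomp Require Import all_boot all_order all_algebra.
From mathcomp Require Import boolp zify ring.

Set Implicit Arguments.
Unset Strict Implicit.
Unset Printing Implicit Defensive.

Import Order.TTheory GRing.Theory Num.Theory.
Local Open Scope ring_scope.

(* The external order embeds the bases of M into the convex sets of the convex
   geometry F |-> F u Act(F), a base B being the set of extreme points of
   B u Ext(B).  The coatoms of L(M) are the sets E - t with t in T not a coloop,
   and a set of coatoms E - t, t in S, has a meet above the bottom iff S is
   independent in M^*|T.  As in the crosscut theorem, the bases that are not such
   meets can be removed from the order complex, those with the largest convex sets
   first: the link of such a vertex is then a cone over the meet of the coatoms
   above it.  What remains is the poset of nonempty independent sets of M^*|T.  Its
   homology is computed by deletion and contraction of an element, and is free of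
   rank |sum_S (-1)^|S|| over the independent sets S; passing to complements, this
   is Rota's expansion of the Moebius function of M.T over spanning sets. *)

(** * Vertex removal in simplicial chain complexes *)

Section Chains.
Variable V : finType.
Implicit Types (c e : chain V) (R S : {set V}) (u v : V) (K : {set {set V}}).

Lemma chainsP K j c : reflect
  (forall S, c S != 0 -> S \in set0 |: K /\ #|S|%:Z = j + 1)
  (c \in chains K j).
Proof.
apply: (iffP forallP) => cK S.
  by move=> cS; have /implyP/(_ cS)/andP[-> /eqP] := cK S.
by apply/implyP => /cK[-> ->]; rewrite eqxx.
Qed.

HB.instance Definition _ K j :=
  GRing.isZmodClosed.Build (chain V) (chains K j) (chains_zmod_closed K j).

Lemma sub_chains K K' j c : K \subset K' -> c \in chains K j -> c \in chains K' j.
Proof.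
move=> KK' /chainsP cK; apply/chainsP => S /cK[SK ->]; split=> //.
exact: (subsetP (setUS _ KK')).
Qed.

Lemma vertex_posU S u v : u \notin S ->
  vertex_pos (u |: S) v = ((enum_rank u < enum_rank v)%N + vertex_pos S v)%N.
Proof.
move=> uS; rewrite /vertex_pos setIdE setIUl -setIdE cardsU [X in (_ - X)%N](_ : _ = 0%N).
  rewrite subn0 -setIdE; congr (_ + _)%N; case: ltnP => uv.
    rewrite (_ : [set _ in _ | _] = [set u]) ?cards1 //.
    by apply/setP => w; rewrite !inE; case: eqP => // ->.
  apply/eqP; rewrite cards_eq0 -subset0; apply/subsetP => w.
  by rewrite !inE => /andP[/eqP->]; rewrite ltnNge uv.
apply/eqP; rewrite cards_eq0 -subset0; apply/subsetP => w.
by rewrite !inE => /andP[/andP[/eqP->]]; rewrite (negPf uS).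
Qed.

Lemma vertex_pos1U S v : vertex_pos (v |: S) v = vertex_pos S v.
Proof.
by apply: eq_card => w; rewrite !inE; case: eqP => // ->; rewrite ltnn !andbF.
Qed.

(** Of [u] and [v], exactly one precedes the other in the enumeration, so exactly one of the two
    products picks up an extra sign. *)
Lemma vertex_pos_swap S u v : u != v -> u \notin S -> v \notin S ->
  (-1) ^+ vertex_pos S v * (-1) ^+ vertex_pos (v |: S) u
  = - ((-1) ^+ vertex_pos S u * (-1) ^+ vertex_pos (u |: S) v) :> int.
Proof.
move=> uv uS vS; rewrite !vertex_posU // !exprD.
have : enum_rank u != enum_rank v :> nat.
  by apply: contra uv => /eqP/val_inj/enum_rank_inj->.
by rewrite neq_ltn; case: ltngtP => //= _ _; ring.
Qed.

Lemma boundaryE c R : boundary c R =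
  \sum_(v | v \notin R) (-1) ^+ vertex_pos R v * c (v |: R).
Proof.
rewrite ffunE (exchange_big_dep predT) //= [RHS]big_mkcond /=.
apply: eq_bigr => v _; case: ifP => vR; last first.
  rewrite big_pred0 // => S; apply/negP => /andP[_ /eqP SR].
  by move: vR; rewrite -SR setD11.
rewrite (big_pred1 (v |: R)) ?vertex_pos1U // => S; apply/andP/eqP => [[vS /eqP<-]|->].
  by rewrite setD1K.
by rewrite setU11 setU1K.
Qed.

Lemma boundary_chains K j c :
  (forall S S' : {set V}, S \subset S' -> S' \in set0 |: K -> S \in set0 |: K) ->
  c \in chains K j -> boundary c \in chains K (j - 1).
Proof.
move=> Kdown /chainsP cK; apply/chainsP => R; rewrite boundaryE => nz.
have [/existsP[v /andP[vR cv]]|] :=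
    boolP [exists v, (v \notin R) && (c (v |: R) != 0)].
  have [vK] := cK _ cv; rewrite cardsU1 vR => e; split; last by lia.
  exact: Kdown (subsetUr _ _) vK.
rewrite negb_exists => /forallP c0; case/eqP: nz; apply: big1 => v vR.
by have := c0 v; rewrite vR /= negbK => /eqP->; rewrite mulr0.
Qed.

Lemma boundaryK c : boundary (boundary c) = 0.
Proof.
apply/ffunP => R; rewrite boundaryE [RHS]ffunE.
(* Extending by 0 to all ordered pairs allows the two orders of removal to be exchanged; by
   [vertex_pos_swap] the sum is its own opposite. *)
pose F u v : int := if [&& u \notin R, v \notin R & u != v] then
  (-1) ^+ vertex_pos R u * (-1) ^+ vertex_pos (u |: R) v * c (v |: (u |: R)) else 0.
have -> : \sum_(v | v \notin R) (-1) ^+ vertex_pos R v * boundary c (v |: R)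
    = \sum_u \sum_v F u v.
  rewrite big_mkcond; apply: eq_bigr => u _; case: ifP => uR; last first.
    by rewrite big1 // => v _; rewrite /F uR.
  rewrite boundaryE mulr_sumr big_mkcond; apply: eq_bigr => v _.
  rewrite /F uR !inE negb_or eq_sym andbC /= mulrA.
  by rewrite andbC.
have anti : \sum_u \sum_v F u v = - \sum_u \sum_v F u v.
  rewrite {1}exchange_big -sumrN; apply: eq_bigr => u _; rewrite -sumrN.
  apply: eq_bigr => v _; rewrite /F [v == u]eq_sym andbCA.
  case: ifP => [/and3P[uR vR uv]|]; last by rewrite oppr0.
  by rewrite vertex_pos_swap // setUCA mulNr.
by lia.
Qed.

(** Faces are oriented by increasing vertices, so moving [v] from the front to its place costs
    [(-1) ^+ vertex_pos S v]. On chains avoiding [v], [link_part] undoes this join. *)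
Definition cone v c : chain V :=
  [ffun S : {set V} => if v \in S then (-1) ^+ vertex_pos S v * c (S :\ v) else 0].

Definition link_part v c : chain V :=
  [ffun S : {set V} => if v \in S then 0 else (-1) ^+ vertex_pos S v * c (v |: S)].

Definition deletion_part v c : chain V :=
  [ffun S : {set V} => if v \in S then 0 else c S].

Lemma link_part_is_zmod_morphism v : zmod_morphism (link_part v).
Proof.
by move=> c e; apply/ffunP => S; rewrite !ffunE; case: ifP; rewrite ?subr0 ?mulrBr.
Qed.

HB.instance Definition _ v :=
  GRing.isZmodMorphism.Build (chain V) (chain V) (link_part v)
    (link_part_is_zmod_morphism v).

Lemma deletion_link c v : c = deletion_part v c + cone v (link_part v c).
Proof.
apply/ffunP => S; rewrite !ffunE setD11; case: ifP => vS; last by rewrite addr0.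
by rewrite add0r setD1K // -[vertex_pos (S :\ v) v]vertex_pos1U setD1K // signrMK.
Qed.

Lemma deletion_part_id c v : link_part v c = 0 -> deletion_part v c = c.
Proof.
move=> c0; rewrite [RHS](deletion_link c v) c0 [cone _ _](_ : _ = 0) ?addr0 //.
by apply/ffunP => S; rewrite !ffunE mulr0 if_same.
Qed.

Definition avoids v c := forall S, v \in S -> c S = 0.

Lemma link_part_avoids c v : avoids v c -> link_part v c = 0.
Proof.
by move=> cv; apply/ffunP => S; rewrite !ffunE cv ?setU11 // mulr0 if_same.
Qed.

Lemma avoids_link_part c v : avoids v (link_part v c).
Proof. by move=> S vS; rewrite ffunE vS. Qed.

Lemma avoids_deletion_part c v : avoids v (deletion_part v c).
Proof. by move=> S vS; rewrite ffunE vS. Qed.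

Lemma link_part_cone c v : avoids v c -> link_part v (cone v c) = c.
Proof.
move=> cv; apply/ffunP => S; rewrite !ffunE; case: ifPn => [/cv//|vS].
by rewrite setU11 setU1K // vertex_pos1U signrMK.
Qed.

(** The sign is that of [vertex_pos_swap]: [v] and the vertex dropped by the boundary are removed in
    opposite orders. Dropping [v] itself contributes nothing, since a link part avoids [v]. *)
Lemma link_part_boundary c v : link_part v (boundary c) = - boundary (link_part v c).
Proof.
apply/ffunP => S; rewrite [LHS]ffunE [RHS]ffunE !boundaryE.
case: ifPn => vS.
  by rewrite big1 ?oppr0 // => u uS; rewrite ffunE setU1r // mulr0.
rewrite mulr_sumr -sumrN [RHS](bigD1 v) //= ffunE setU11 mulr0 oppr0 add0r.
apply: eq_big => u; first by rewrite !inE negb_or andbC.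
rewrite !inE negb_or => /andP[uv uS].
rewrite ffunE !inE (negPf vS) orbF eq_sym (negPf uv) mulrA vertex_pos_swap //.
by rewrite setUCA; ring.
Qed.

(* With [cone v c] read as [v * c], this is d (v * c) = c - v * d c. *)
Lemma boundary_cone c v : avoids v c ->
  boundary (cone v c) = c - cone v (boundary c).
Proof.
move=> cv; apply/ffunP => R.
have [vR|vR] := boolP (v \in R); last first.
  rewrite boundaryE (bigD1 v) //= big1 => [|u /andP[uR uv]]; last first.
    by rewrite ffunE !inE (negPf vR) orbF eq_sym (negPf uv) mulr0.
  rewrite !ffunE setU11 (negPf vR) setU1K // vertex_pos1U signrMK.
  by rewrite oppr0 !addr0.
have vQ : v \notin R :\ v by rewrite setD11.
rewrite -(setD1K vR); move: (R :\ v) vQ => Q vQ.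
rewrite [RHS]ffunE cv ?setU11 // add0r [RHS]ffunE [X in - X]ffunE setU11 setU1K //.
rewrite !boundaryE [X in _ * X](bigD1 v) //= cv ?setU11 // mulr0 add0r.
rewrite mulr_sumr -sumrN; apply: eq_big => u; first by rewrite !inE negb_or andbC.
rewrite !inE negb_or => /andP[uv uQ].
rewrite ffunE !inE eqxx orbT vertex_pos1U setUCA setU1K; last first.
  by rewrite !inE eq_sym (negPf uv).
rewrite vertex_pos1U mulrA mulrA -mulNr; congr (_ * _).
rewrite !vertex_posU // !exprD.
have : enum_rank u != enum_rank v :> nat.
  by apply: contra uv => /eqP/val_inj/enum_rank_inj->.
by rewrite neq_ltn; case: ltngtP => //= _ _; ring.
Qed.

(** The classes of the [z k] form a basis of the homology group. Stated on chains, so that bases can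
    be glued by explicit formulas before any quotient is taken. *)
Definition free_homology K (j : int) (n : nat) : Prop :=
  exists z : 'I_n -> chain V,
  [/\ forall k, z k \in cycles K j,
      forall c, c \in cycles K j -> exists a : 'I_n -> int,
        exists2 b, b \in chains K (j + 1) & c = \sum_k z k *~ a k + boundary b
    & forall (a : 'I_n -> int) b, b \in chains K (j + 1) ->
        \sum_k z k *~ a k = boundary b -> forall k, a k = 0].

Lemma free_homology_isomorphic K j n : free_homology K j n ->
  zmod_isomorphic (reduced_homology K j) 'rV[int]_n.
Proof.
case=> z [zK zgen zind].
have sumK (a : 'rV[int]_n) : \sum_k z k *~ a 0 k \in cycles K j.
  by apply: rpred_sum => k _; rewrite rpredMz.
pose cyc a : cycle_group K j := exist (fun c => c \in cycles K j) _ (sumK a).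
pose g a : reduced_homology K j := \pi_(reduced_homology K j)%qT (cyc a).
have gB : zmod_morphism g.
  move=> a b; rewrite /g -raddfB; congr (\pi_ _ _)%qT; apply/val_inj => /=.
  by rewrite -sumrB; apply: eq_bigr => k _; rewrite !mxE mulrzBr.
pose gA : {additive 'rV[int]_n -> reduced_homology K j} :=
  HB.pack_for {additive _ -> _} g (GRing.isZmodMorphism.Build _ _ g gB).
have ginj : injective gA.
  have pi0 : (0 : reduced_homology K j) = \pi_(reduced_homology K j)%qT 0.
    by rewrite raddf0.
  apply/raddf_inj => a /eqP; rewrite /= /g pi0 -Quotient.idealrBE subr0 => /asboolP[b bK /= /(zind _ _ bK) a0].
  by apply/rowP => k; rewrite mxE a0.
have gsurj h : exists a, gA a = h.
  rewrite -[h]reprK; have [a [b bK e]] := zgen _ (valP (repr h)).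
  exists (\row_k a k); apply/eqP; rewrite /= /g -Quotient.idealrBE.
  apply/asboolP; exists (- b); first by rewrite rpredN.
  rewrite /= e raddfN /= opprD addrA -[RHS]add0r; congr (_ - _).
  by apply/eqP; rewrite subr_eq0; apply/eqP/eq_bigr => k _; rewrite mxE.
pose f h := projT1 (cid (gsurj h)).
have fK : cancel f gA by move=> h; rewrite /f; case: cid.
have gK : cancel gA f by move=> a; apply: ginj; rewrite fK.
pose fA : {additive reduced_homology K j -> 'rV[int]_n} :=
  HB.pack_for {additive _ -> _} f
    (GRing.isZmodMorphism.Build _ _ f (can2_zmod_morphism gK fK)).
by exists fA; exists gA.
Qed.

Lemma cone_chains K K' j v e : 
  (forall S, S \in set0 |: K' -> v \notin S -> v |: S \in set0 |: K) ->
  avoids v e -> e \in chains K' j -> cone v e \in chains K (j + 1).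
Proof.
move=> KK' ev /chainsP eK; apply/chainsP => S; rewrite ffunE.
case: ifP => [vS nz|]; last by rewrite eqxx.
have /eK[SK cS] : e (S :\ v) != 0 by apply: contraNneq nz => ->; rewrite mulr0.
split; last by rewrite (cardsD1 v) vS; lia.
by rewrite -(setD1K vS) KK' ?setD11.
Qed.

Lemma link_part_chains K K' j v c :
  (forall S, v |: S \in set0 |: K -> v \notin S -> S \in set0 |: K') ->
  c \in chains K j -> link_part v c \in chains K' (j - 1).
Proof.
move=> KK' /chainsP cK; apply/chainsP => S; rewrite ffunE.
case: ifPn => [_|vS nz]; first by rewrite eqxx.
have /cK[SK] : c (v |: S) != 0 by apply: contraNneq nz => ->; rewrite mulr0.
by rewrite cardsU1 vS => e; split; [apply: KK'|lia].
Qed.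

Lemma deletion_part_chains K K' j v c :
  (forall S, S \in set0 |: K -> v \notin S -> S \in set0 |: K') ->
  c \in chains K j -> deletion_part v c \in chains K' j.
Proof.
move=> KK' /chainsP cK; apply/chainsP => S; rewrite ffunE.
by case: ifPn => [_|vS /cK[SK ->]]; rewrite ?eqxx //; split=> //; apply: KK'.
Qed.

Lemma cyclesP K j c : reflect (c \in chains K j /\ boundary c = 0) (c \in cycles K j).
Proof. by apply: (iffP andP) => -[cK /eqP]. Qed.

Definition deletion K v := [set S in K | v \notin S].
Definition link K v := [set S in K | (v \notin S) && (v |: S \in K)].

(** When [K \subset K'], this says that the inclusion induces the zero map on reduced homology in
    degree [j]. *)
Definition bounds K K' j :=
  forall c, c \in cycles K j -> exists2 b, b \in chains K' (j + 1) & c = boundary b.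

Lemma free_homology0 K j : free_homology K j 0 -> bounds K K j.
Proof.
case=> z [_ zgen _] c /zgen[a [b bK ->]].
by exists b => //; rewrite big_ord0 add0r.
Qed.

Definition complex K := forall S S', S \subset S' -> S' \in K -> S != set0 -> S \in K.

Lemma complexU1 K : complex K -> forall S S' : {set V}, S \subset S' ->
  S' \in set0 |: K -> S \in set0 |: K.
Proof.
move=> Kc S S' SS'; rewrite !inE => /orP[/eqP S'0|S'K].
  by rewrite S'0 subset0 in SS'; rewrite SS'.
by have [//|S0] := eqVneq S set0; rewrite (Kc _ _ SS').
Qed.

(** [K] is the union of [deletion K v] and the cone over [link K v]. The two [bounds] hypotheses cut
    the Mayer-Vietoris sequence into a short exact one, from degree [j] of the deletion to degree
    [j - 1] of the link. A basis consists of a basis of the former and lifts of a basis of the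
    latter. *)
Lemma free_homology_glue K v j n m : complex K -> [set v] \in K ->
  bounds (link K v) (deletion K v) j -> bounds (link K v) (deletion K v) (j - 1) ->
  free_homology (link K v) (j - 1) m -> free_homology (deletion K v) j n ->
  free_homology K j (n + m).
Proof.
move=> Kc vK bnd bnd1 [y [ycyc ygen yind]] [x [xcyc xgen xind]].
have K0 := complexU1 Kc.
have LD : link K v \subset deletion K v.
  by apply/subsetP => S; rewrite !inE => /and3P[-> ->].
have DK : deletion K v \subset K by apply/subsetP => S; rewrite inE => /andP[].
have Lav i c : c \in chains (link K v) i -> avoids v c.
  move=> /chainsP cL S vS; apply/eqP; apply: contraT => /cL[].
  rewrite !inE vS andbF orbF => /eqP S0.
  by rewrite S0 inE in vS.
have Dav i c : c \in chains (deletion K v) i -> avoids v c.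
  move=> /chainsP cL S vS; apply/eqP; apply: contraT => /cL[].
  rewrite !inE vS andbF orbF => /eqP S0.
  by rewrite S0 inE in vS.
have Lcone i c : c \in chains (link K v) i -> cone v c \in chains K (i + 1).
  move=> cL; apply: (cone_chains _ (Lav _ _ cL) cL) => S; rewrite !inE => SL vS.
  by case/orP: SL => [/eqP->|/and3P[_ _ ->]]; rewrite ?setU0 ?vK orbT.
have Lpart i c : c \in chains K i -> link_part v c \in chains (link K v) (i - 1).
  apply: link_part_chains => S; rewrite !inE => /orP[/eqP/setP/(_ v)|vSK vS].
    by rewrite !inE eqxx.
  have [//|S0] := eqVneq S set0.
  by rewrite vS vSK (Kc _ _ (subsetUr _ _) vSK S0).
have Dpart i c : c \in chains K i -> deletion_part v c \in chains (deletion K v) i.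
  by apply: deletion_part_chains => S; rewrite !inE => /orP[-> //|->] ->; rewrite orbT.
have part0 i c : c \in chains K i -> link_part v c = 0 -> c \in chains (deletion K v) i.
  by move=> /Dpart cD /deletion_part_id <-.
have bdry i c : c \in chains K i -> boundary c \in chains K (i - 1).
  exact: boundary_chains.
have part_cycle i c : c \in cycles K i -> link_part v c \in cycles (link K v) (i - 1).
  move=> /cyclesP[cK bc]; apply/cyclesP; split; first exact: Lpart.
  by apply: oppr_inj; rewrite -link_part_boundary bc raddf0 oppr0.
have /fin_all_exists2[b bD yb] k : exists2 b,
    b \in chains (deletion K v) j & y k = boundary b.
  by have := bnd1 _ (ycyc k); rewrite subrK.
(* A cycle of the link is filled twice, by its cone and inside the deletion; the difference is a
   cycle of [K] whose link part is [y k]. *)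
pose zv k := cone v (y k) - b k.
have yav k : avoids v (y k) by have /cyclesP[/Lav] := ycyc k.
have link_zv k : link_part v (zv k) = y k.
  by rewrite raddfB /= link_part_cone // (link_part_avoids (Dav _ _ (bD k))) subr0.
have cone0 : cone v 0 = 0.
  by apply/ffunP => S; rewrite !ffunE mulr0 if_same.
have zvcyc k : zv k \in cycles K j.
  have /cyclesP[yL y0] := ycyc k; apply/cyclesP; split.
    by rewrite rpredB ?(sub_chains DK (bD k)) //; have := Lcone _ _ yL; rewrite subrK.
  by rewrite raddfB /= boundary_cone // y0 cone0 subr0 -yb subrr.
pose z (k : 'I_(n + m)) := match split k with inl i => x i | inr i => zv i end.
have sl i : split (lshift m i : 'I_(n + m)) = inl i := unsplitK (inl i).
have sr i : split (rshift n i : 'I_(n + m)) = inr i := unsplitK (inr i).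
have zl i : z (lshift m i) = x i by rewrite /z sl.
have zr i : z (rshift n i) = zv i by rewrite /z sr.
exists z; split.
- move=> k; rewrite /z; case: split => i //.
  by have /cyclesP[xD x0] := xcyc i; apply/cyclesP; rewrite (sub_chains DK).
- move=> c cc; have /cyclesP[cK c0] := cc.
  have [a [f]] := ygen _ (part_cycle _ _ cc); rewrite subrK => fL ef.
  (* Subtracting the lifts leaves the link part [boundary f], which the last term cancels; hence
     [c'] lives in the deletion. *)
  pose c' := c - \sum_k zv k *~ a k + boundary (cone v f).
  have fav := Lav _ _ fL.
  have c'K : c' \in chains K j.
    rewrite rpredD ?rpredB //; last by have := bdry _ _ (Lcone _ _ fL); rewrite addrK.
    by apply: rpred_sum => k _; rewrite rpredMz //; have /cyclesP[] := zvcyc k.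
  have c'0 : boundary c' = 0.
    rewrite raddfD raddfB /= boundaryK c0 raddf_sum big1 ?subr0 ?addr0 // => k _.
    by have /cyclesP[_ zv0] := zvcyc k; rewrite raddfMz /= zv0 mul0rz.
  have c'D : c' \in chains (deletion K v) j.
    apply: part0 => //; rewrite raddfD raddfB /= raddf_sum /= link_part_boundary.
    rewrite link_part_cone // ef; apply/eqP; rewrite subr_eq0 addrAC addrC.
    rewrite [X in _ + X](_ : _ = 0) ?addr0 //; apply/eqP; rewrite subr_eq0.
    by apply/eqP/eq_bigr => k _; rewrite raddfMz /= link_zv.
  have [a' [g gD eg]] := xgen c' (introT (cyclesP _ _ _) (conj c'D c'0)).
  exists (fun k => match split k with inl i => a' i | inr i => a i end).
  exists (g - cone v f); first by rewrite rpredB ?(sub_chains DK gD) ?Lcone.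
  rewrite big_split_ord /= raddfB /=.
  have -> : c = c' + \sum_k zv k *~ a k - boundary (cone v f).
    by rewrite /c' addrAC addrK subrK.
  rewrite eg addrA; congr (_ - _); rewrite addrAC; congr (_ + _ + _).
    by apply: eq_bigr => i _; rewrite zl sl.
  by apply: eq_bigr => i _; rewrite zr sr.
- move=> a g gK; rewrite big_split_ord /= => e.
  (* Taking link parts turns the relation into one among the [y k]. *)
  have ar i : a (rshift n i) = 0.
    apply: (yind (fun i => a (rshift n i)) (- link_part v g)).
      by rewrite rpredN subrK; have := Lpart _ _ gK; rewrite addrK.
    rewrite raddfN /= -link_part_boundary -e raddfD /= !raddf_sum /= [X in _ = X + _]big1.
      by rewrite add0r; apply: eq_bigr => k _; rewrite zr raddfMz /= link_zv.
    move=> k _; have /cyclesP[/Dav/link_part_avoids xk _] := xcyc k.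
    by rewrite zl raddfMz /= xk mul0rz.
  have ex : \sum_k x k *~ a (lshift m k) = boundary g.
    rewrite -e [X in _ = _ + X]big1 ?addr0 => [|k _]; last by rewrite ar mulr0z.
    by apply: eq_bigr => k _; rewrite zl.
  (* The link part of [g] is now a cycle of the link, hence the boundary of some [f] in the
     deletion; trading its cone for [f] keeps the boundary of [g]. *)
  have [f fD ef] : exists2 f, f \in chains (deletion K v) (j + 1)
      & link_part v g = boundary f.
    apply: bnd; apply/cyclesP; split; first by have := Lpart _ _ gK; rewrite addrK.
    apply: oppr_inj; rewrite -link_part_boundary -ex raddf_sum big1 ?oppr0 // => k _.
    have /cyclesP[/Dav/link_part_avoids xk _] := xcyc k.
    by rewrite raddfMz /= xk mul0rz.
  have al : forall i, a (lshift m i) = 0.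
    apply: (xind _ (deletion_part v g + f)); first by rewrite rpredD ?Dpart.
    rewrite ex {1}(deletion_link g v) !raddfD /= boundary_cone; last exact: avoids_link_part.
    by rewrite ef boundaryK cone0 subr0.
  by move=> k; case: (split_ordP k) => i ->.
Qed.

(** Write a cycle as [c = d + cone v l] with deletion part [d] and link part [l]. Being a cycle
    forces [boundary d = - l], so [cone v d] has boundary [d + cone v l = c]. *)
Lemma cone_acyclic K v j : (forall S, S \in set0 |: K -> v |: S \in K) ->
  free_homology K j 0.
Proof.
move=> vK; exists (fun _ => 0); split=> [k|c|a b bK _ []//].
  by rewrite rpred0.
move=> /cyclesP[cK c0]; exists (fun _ => 0), (cone v (deletion_part v c)).
  apply: (cone_chains (K' := K)); [|exact: avoids_deletion_part|].
    by move=> S SK _; rewrite inE vK // orbT.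
  exact: deletion_part_chains cK.
rewrite big_ord0 add0r boundary_cone; last exact: avoids_deletion_part.
have e := deletion_link c v.
have lc : boundary (link_part v c) = 0.
  by apply: oppr_inj; rewrite -link_part_boundary c0 raddf0 oppr0.
have cone0 : cone v 0 = 0 by apply/ffunP => S; rewrite !ffunE mulr0 if_same.
have bl : boundary (cone v (link_part v c)) = link_part v c.
  by rewrite boundary_cone ?lc ?cone0 ?subr0 //; apply: avoids_link_part.
have : boundary (deletion_part v c) = - link_part v c.
  by apply/eqP; rewrite -addr_eq0 -[X in _ + X]bl -raddfD /= -e c0.
move=> ->; rewrite {1}e; congr (_ + _); apply/ffunP => S; rewrite !ffunE.
by case: ifP; rewrite ?oppr0 // => vS; rewrite setD11 mulrN opprK.
Qed.

End Chains.

(** * Order complexes *)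

Section Posets.
Variables (V : finType) (le : rel V).
Hypothesis le_refl : reflexive le.
Implicit Types (P Q S : {set V}) (x y z : V).

Definition comparable x y := le x y || le y x.

Lemma comparable_sym : symmetric comparable.
Proof. by move=> x y; rewrite /comparable orbC. Qed.

Lemma order_complexP P S : reflect
  [/\ S \subset P, S != set0 & {in S &, forall x y, comparable x y}]
  (S \in order_complex P le).
Proof.
rewrite inE; apply: (iffP and3P) => -[SP S0 Sc]; split=> //.
  by move=> x y xS yS; move/forall_inP/(_ x xS)/forall_inP/(_ y yS): Sc.
by apply/forall_inP => x xS; apply/forall_inP => y yS; apply: Sc.
Qed.

Lemma order_complex_complex P : complex (order_complex P le).
Proof.
move=> S S' SS' /order_complexP[S'P _ cS'] S0; apply/order_complexP; split=> //.
  exact: subset_trans SS' S'P.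
by move=> x y /(subsetP SS') xS /(subsetP SS') yS; apply: cS'.
Qed.

(** The homology of a wedge of [n] spheres of dimension [d]; for [n = 0], acyclicity. *)
Definition spherical P (d : int) n := forall j,
  free_homology (order_complex P le) j (if j == d then n else 0%N).

(** Only the empty face is left: the sphere of dimension -1, base case of the deletion-contraction
    induction. *)
Lemma spherical0 : spherical set0 (-1) 1.
Proof.
move=> j.
have K0 : order_complex set0 le = set0.
  by apply/setP => S; rewrite !inE subset0 andbA andbN.
rewrite K0; have chains0 (c : chain V) i : i != -1 -> c \in chains set0 i -> c = 0.
  move=> i1 /chainsP c0; apply/ffunP => S; rewrite [RHS]ffunE.
  apply/eqP; apply: contraT => /c0[]; rewrite setU0 inE => /eqP->.
  by rewrite cards0 => e; case/eqP: i1; lia.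
case: eqP => [->|/eqP j1]; last first.
  exists (fun _ => 0); split=> [k|c|a b _ _ []//]; first by rewrite rpred0.
  move=> /cyclesP[cK _]; exists (fun _ => 0), 0; first by rewrite rpred0.
  by rewrite big_ord0 raddf0 addr0; apply: chains0 cK.
pose z : chain V := [ffun S : {set V} => if S == set0 then 1 else 0].
have zE (c : chain V) : c \in chains set0 (-1) -> c = z *~ c set0.
  move=> /chainsP cK; apply/ffunP => S; rewrite ffunMzE ffunE.
  case: eqP => [->|/eqP S0]; first by rewrite intz.
  by rewrite mul0rz; apply/eqP; apply: contraNT S0 => /cK[]; rewrite setU0 inE.
have b0 (b : chain V) : b \in chains set0 (-1 + 1) -> b = 0 by apply: chains0.
exists (fun _ => z); split.
- move=> _; apply/cyclesP; split.
    apply/chainsP => S; rewrite ffunE; case: (S =P set0) => [->|_]; last by rewrite eqxx.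
    by rewrite cards0 setU11.
  apply/ffunP => R; rewrite boundaryE [RHS]ffunE big1 // => v _; rewrite ffunE.
  case: eqP => [/setP/(_ v)|]; last by rewrite mulr0.
  by rewrite !inE eqxx.
- move=> c /cyclesP[/zE cK _]; exists (fun _ => c set0), 0; rewrite ?rpred0 //.
  by rewrite big_ord1 raddf0 addr0.
move=> a b /b0->; rewrite big_ord1 raddf0 => /ffunP/(_ set0).
rewrite ffunMzE !ffunE eqxx => e k; rewrite ord1.
by move: e; rewrite intz.
Qed.

Lemma cone_spherical P x d :
  x \in P -> {in P, forall y, comparable x y} -> spherical P d 0.
Proof.
move=> xP xc j; rewrite if_same; apply: (@cone_acyclic _ _ x) => S.
move=> /setU1P[->|/order_complexP[SP S0 cS]]; apply/order_complexP.
  rewrite setU0 sub1set xP; split=> //; first by apply/set0Pn; exists x; rewrite inE.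
  by move=> y z; rewrite !inE => /eqP-> /eqP->; rewrite /comparable le_refl.
split; first by rewrite subUset sub1set xP.
  by apply/set0Pn; exists x; rewrite setU11.
move=> y z /setU1P[->|yS] /setU1P[->|zS]; last exact: cS.
- by rewrite /comparable le_refl.
- by rewrite xc // (subsetP SP).
- by rewrite comparable_sym xc // (subsetP SP).
Qed.

Definition neighbours P x := [set y in P :\ x | comparable x y].

Lemma deletion_order_complex P x :
  deletion (order_complex P le) x = order_complex (P :\ x) le.
Proof.
apply/setP => S; rewrite inE; apply/andP/order_complexP.
  by case=> /order_complexP[SP S0 cS] xS; rewrite subsetD1 SP.
case; rewrite subsetD1 => /andP[SP xS] S0 cS; split=> //.
exact/order_complexP.
Qed.

Lemma link_order_complex P x : x \in P ->
  link (order_complex P le) x = order_complex (neighbours P x) le.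
Proof.
move=> xP; apply/setP => S; rewrite inE; apply/and3P/order_complexP.
  case=> /order_complexP[SP S0 cS] xS /order_complexP[_ _ cxS]; split=> //.
  apply/subsetP => y yS; rewrite !inE (subsetP SP) // cxS ?setU11 ?setU1r // !andbT.
  by apply: contraNneq xS => <-.
case=> SN S0 cS.
have SP y : y \in S -> [/\ y \in P, y != x & comparable x y].
  by move=> /(subsetP SN); rewrite !inE => /andP[/andP[-> ->] ->].
have SsP : S \subset P by apply/subsetP => y /SP[].
split; first exact/order_complexP.
  by apply/negP => /SP[_]; rewrite eqxx.
apply/order_complexP; split; first by rewrite subUset sub1set xP.
  by apply/set0Pn; exists x; rewrite setU11.
move=> y z /setU1P[->|yS] /setU1P[->|zS]; last exact: cS.
- by rewrite /comparable le_refl.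
- by case: (SP z zS).
- by rewrite comparable_sym; case: (SP y yS).
Qed.

Lemma spherical_remove P x d n m : x \in P ->
  spherical (neighbours P x) (d - 1) m -> spherical (P :\ x) d n ->
  spherical P d (n + m).
Proof.
move=> xP sN sD j.
have -> : (if j == d then (n + m)%N else 0%N)
  = addn (if j == d then n else 0%N) (if j - 1 == d - 1 then m else 0%N).
  by rewrite (inj_eq (addIr _)); case: eqP.
have bnd i : bounds (link (order_complex P le) x) (deletion (order_complex P le) x) i.
  rewrite link_order_complex // deletion_order_complex => c cc.
  have ND : order_complex (neighbours P x) le \subset order_complex (P :\ x) le.
    apply/subsetP => S /order_complexP[SN S0 cS]; apply/order_complexP; split=> //.
    by apply: subset_trans SN _; rewrite /neighbours setIdE subsetIl.
  (* In degree [d] the link has no homology; in every other degree the deletion has none. *)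
  have [ed|nd] := eqVneq i d.
    have := sN i; rewrite (_ : (i == d - 1) = false); last by apply/eqP; lia.
    by move=> /free_homology0/(_ c cc)[b bN ->]; exists b; rewrite ?(sub_chains ND).
  have := sD i; rewrite (negPf nd) => /free_homology0; apply.
  by have /cyclesP[cN c0] := cc; apply/cyclesP; rewrite (sub_chains ND).
apply: (@free_homology_glue _ _ x) => //; first exact: order_complex_complex.
- apply/order_complexP; rewrite sub1set; split=> //.
    by apply/set0Pn; exists x; rewrite inE.
  by move=> y z; rewrite !inE => /eqP-> /eqP->; rewrite /comparable le_refl.
- by rewrite link_order_complex //; apply: sN.
- by rewrite deletion_order_complex; apply: sD.
Qed.

(** The link of [x] is a cone with apex [y], so it contributes rank 0. *)
Lemma spherical_dominated P x y d n : x \in P -> y \in neighbours P x ->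
  {in neighbours P x, forall z, comparable y z} ->
  spherical (P :\ x) d n -> spherical P d n.
Proof.
move=> xP yN yc sD; rewrite -[n]addn0; apply: spherical_remove sD => //.
exact: cone_spherical yc.
Qed.

(** Points outside [Q] are removed one by one, so a dominated point has to be supplied in every
    intermediate [P']. The order of removal is left to the proof of that hypothesis. *)
Lemma spherical_retract P Q d n : Q \subset P ->
  (forall P', Q \subset P' -> P' \subset P -> P' != Q ->
     exists x y, [/\ x \in P' :\: Q, y \in neighbours P' x
       & {in neighbours P' x, forall z, comparable y z}]) ->
  spherical Q d n -> spherical P d n.
Proof.
move=> QP step sQ.
suff main k P' : Q \subset P' -> P' \subset P -> #|P'| = k -> spherical P' d n.
  exact: main (subxx P) (erefl _).
elim: k P' => [|k IHk] P' QP' P'P cP'.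
  have P'0 : P' = set0 by apply/eqP; rewrite -cards_eq0 cP'.
  by move: QP'; rewrite P'0 subset0 => /eqP <-.
have [->//|nQ] := eqVneq P' Q.
have [x [y [/setDP[xP' xQ] yN yc]]] := step P' QP' P'P nQ.
apply: (spherical_dominated xP' yN yc); apply: IHk.
- by rewrite subsetD1 QP'.
- exact: subset_trans (subsetDl _ _) P'P.
- by move: cP'; rewrite (cardsD1 x) xP' => -[].
Qed.

End Posets.

(** * Independence complexes of matroids *)

Section RankClosure.
Variables (E : finType) (N : matroid E).
Implicit Types (F G I J X Y S : {set E}) (e : E).

Lemma leq_rk I F : I \in indep N -> I \subset F -> (#|I| <= rk N F)%N.
Proof.
by move=> Ii IF; apply: (@leq_bigmax_cond _ _ (fun I : {set E} => #|I|)); rewrite Ii.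
Qed.

Lemma basis_exists I F : I \in indep N -> I \subset F ->
  exists J, [/\ J \in indep N, I \subset J, J \subset F & #|J| = rk N F].
Proof.
move=> Ii IF; have [J [Ji IJ JF Jmax]] := indep_maxset Ii IF.
exists J; split=> //; apply/eqP; rewrite eqn_leq leq_rk //=.
by apply/bigmax_leqP => K /andP[Ki KF]; apply: Jmax.
Qed.

Lemma rkS F G : F \subset G -> (rk N F <= rk N G)%N.
Proof.
move=> FG; have [J [Ji _ JF <-]] := basis_exists (indep0 N) (sub0set F).
by rewrite leq_rk // (subset_trans JF).
Qed.

Lemma rk_indep I : I \in indep N -> rk N I = #|I|.
Proof.
move=> Ii; have [J [_ IJ JI <-]] := basis_exists Ii (subxx I).
by congr #|pred_of_set _|; apply/eqP; rewrite eqEsubset JI.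
Qed.

Lemma rk_basis_aug F J e : J \in indep N -> #|J| = rk N F -> e \in F ->
  e |: J \in indep N -> J \subset F -> e \in J.
Proof.
move=> Ji cJ eF eJ JF; apply: contraT => neJ.
have := leq_rk (F := F) eJ; rewrite subUset sub1set eF JF cardsU1 neJ -cJ => /(_ isT).
by rewrite ltnn.
Qed.

(** If [e] raised the rank of [F], then [J] could be augmented inside [e |: F], and maximality of
    [J] in [F] would make [e] the new element. Closure can thus be tested on any one basis. *)
Lemma mclosure_basis F J e : J \in indep N -> J \subset F -> #|J| = rk N F ->
  e \in ground N ->
  (e \in mclosure N F) = (e \in J) || (e |: J \notin indep N).
Proof.
move=> Ji JF cJ eE; rewrite inE eE /=; apply/idP/idP.
  move=> /eqP re; apply: contraT; rewrite negb_or negbK => /andP[neJ eJ].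
  have := leq_rk eJ (setUS _ JF).
  by rewrite re cardsU1 neJ cJ ltnn.
move=> eJ; rewrite eqn_leq andbC rkS ?subsetUr //= -cJ leqNgt.
apply/negP => lt.
have [J' [J'i _ J'F cJ']] := basis_exists (indep0 N) (sub0set (e |: F)).
rewrite -cJ' in lt; have [x /setDP[xJ' xJ] xJi] := indep_aug Ji J'i lt.
have /setU1P[xe|xF] := subsetP J'F x xJ'.
  by move: eJ; rewrite -xe xJi (negPf xJ).
by case/negP: xJ; apply: rk_basis_aug xJi JF.
Qed.

Lemma mclosure_ground F : mclosure N F \subset ground N.
Proof. by rewrite /mclosure setIdE subsetIl. Qed.

Lemma sub_mclosure F : F \subset ground N -> F \subset mclosure N F.
Proof.
move=> FE; apply/subsetP => e eF; rewrite inE (subsetP FE) //=.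
by rewrite (setUidPr _) ?sub1set.
Qed.

(** A basis of [F] extends to one of [G], and dependence over the smaller basis persists over the
    larger. *)
Lemma mclosureS F G : F \subset G -> mclosure N F \subset mclosure N G.
Proof.
move=> FG; have [J [Ji _ JF cJ]] := basis_exists (indep0 N) (sub0set F).
have [J' [J'i JJ' J'G cJ']] := basis_exists Ji (subset_trans JF FG).
apply/subsetP => e ecl; have eE := subsetP (mclosure_ground F) e ecl.
move: ecl; rewrite (mclosure_basis Ji) // (mclosure_basis J'i) //.
case/orP=> [/(subsetP JJ')->//|eJ]; apply/orP; right.
by apply: contra eJ; apply: indepS; apply: setUS.
Qed.

Lemma basis_mclosure F J : J \in indep N -> J \subset F -> #|J| = rk N F ->
  J \subset mclosure N F /\ #|J| = rk N (mclosure N F).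
Proof.
move=> Ji JF cJ; have JE := indep_ground Ji.
have Jcl : J \subset mclosure N F.
  by apply/subsetP => e eJ; rewrite (mclosure_basis Ji) ?eJ // (subsetP JE).
split=> //; apply/eqP; rewrite eqn_leq leq_rk //= leqNgt; apply/negP.
have [J' [J'i _ J'F <-]] := basis_exists (indep0 N) (sub0set (mclosure N F)).
move=> /(indep_aug Ji J'i)[x /setDP[xJ' xJ] xJi].
have := subsetP J'F x xJ'; rewrite (mclosure_basis Ji) // ?xJi ?(negPf xJ) //.
exact: (subsetP (indep_ground J'i)).
Qed.

(** [F] and its closure share a basis, and the basis determines the closure. *)
Lemma mclosureK F : mclosure N (mclosure N F) = mclosure N F.
Proof.
have [J [Ji _ JF cJ]] := basis_exists (indep0 N) (sub0set F).
have [Jcl cJcl] := basis_mclosure Ji JF cJ.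
apply/setP => e; have [eE|eE] := boolP (e \in ground N).
  by rewrite !(mclosure_basis Ji).
by rewrite !inE (negPf eE).
Qed.

Lemma mclosure_sub F G : F \subset mclosure N G -> mclosure N F \subset mclosure N G.
Proof. by move=> FG; rewrite -[mclosure N G]mclosureK; apply: mclosureS. Qed.

Lemma indep_mclosure I e : I \in indep N -> e \in ground N ->
  (e \in mclosure N I) = (e \in I) || (e |: I \notin indep N).
Proof. by move=> Ii; apply: mclosure_basis; rewrite ?rk_indep. Qed.

End RankClosure.

(** Toggling [e] is a sign-reversing involution of the index set. *)
Lemma sum_sign_toggle (E : finType) (P : pred {set E}) e :
  (forall A : {set E}, e \notin A -> P (e |: A) = P A) ->
  \sum_(A : {set E} | P A) (-1) ^+ #|A| = 0 :> int.
Proof.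
move=> Pe; rewrite (bigID (fun A : {set E} => e \in A)) /=.
rewrite (reindex_onto (fun A : {set E} => e |: A) (fun A : {set E} => A :\ e)) /=; last first.
  by move=> A /andP[_ eA]; rewrite setD1K.
rewrite [X in X + _](eq_bigl (fun A : {set E} => P A && (e \notin A))) => [|A].
  rewrite -big_split big1 //= => A /andP[_ eA].
  by rewrite cardsU1 eA exprD mulN1r addNr.
rewrite setU11 andbT; have [eA|eA] := boolP (e \in A).
  rewrite andbF; apply/negP => /andP[_ /eqP/setP/(_ e)].
  by rewrite !inE eqxx eA.
by rewrite setU1K // eqxx !andbT Pe.
Qed.

(** * Deletion and contraction for posets of independent sets *)

Section IndependenceComplex.
Variables (E : finType) (N : matroid E) (V : finType) (le : rel V).
(** A copy of the independent sets with inclusion reversed. In the application [S] goes to a meet of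
    coatoms, which shrinks as [S] grows. *)
Variable phi : {set E} -> V.
Hypothesis le_refl : reflexive le.
Hypothesis phi_le : {in indep N &, forall S S', le (phi S) (phi S') = (S' \subset S)}.
Implicit Types (F I J X Y S : {set E}) (e : E).

(** For [X] independent and inside [Y], subtracting [X] gives the nonempty faces of the link of [X]
    in the independence complex of [N] restricted to [Y]. *)
Definition faces X Y : {set {set E}} :=
  [set S in indep N | (X \proper S) && (S \subset Y)].

Lemma phi_inj : {in indep N &, injective phi}.
Proof.
move=> S S' Si S'i e; apply/eqP; rewrite eqEsubset -phi_le // -[S' \subset S]phi_le //.
by rewrite e le_refl.
Qed.

Lemma phi_comparable S S' : S \in indep N -> S' \in indep N ->
  comparable le (phi S) (phi S') = (S \subset S') || (S' \subset S).
Proof. by move=> Si S'i; rewrite /comparable !phi_le // orbC. Qed.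

Lemma mem_phi (A : {set {set E}}) S : A \subset indep N -> S \in indep N ->
  (phi S \in phi @: A) = (S \in A).
Proof.
move=> Ai Si; apply/imsetP/idP => [[S' S'A /phi_inj-> //]|SA]; last by exists S.
exact: (subsetP Ai).
Qed.

Lemma faces_indep X Y : faces X Y \subset indep N.
Proof. by rewrite /faces setIdE subsetIl. Qed.

(** A set [S] containing [e] is dominated by [S :\ e] when the sets are removed by increasing size:
    the proper subsets of [S] still present then avoid [e]. *)
Lemma spherical_restrict X Y e d n : X \in indep N -> e \in Y -> e \notin X ->
  e |: X \in indep N ->
  spherical le (phi @: faces X (Y :\ e)) d n ->
  spherical le ((phi @: faces X Y) :\ phi (e |: X)) d n.
Proof.
move=> Xi eY eX eXi; apply: (spherical_retract le_refl).
  apply/subsetP => _ /imsetP[S SF ->]; have Si := subsetP (faces_indep _ _) S SF.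
  move: SF; rewrite !inE Si /= subsetD1 => /and3P[XS SY eS].
  rewrite mem_phi ?faces_indep // inE Si XS SY !andbT.
  apply: contraNneq eS => /phi_inj -> //; exact: setU11.
move=> P' QP' P'P nQ.
have P'F x : x \in P' -> exists S, [/\ x = phi S, S \in faces X Y & S != e |: X].
  move=> /(subsetP P'P)/setD1P[xn /imsetP[S SF xS]]; exists S; split=> //.
  by apply: contraNneq xn => <-; rewrite xS.
have memQ S : S \in faces X Y -> (phi S \in phi @: faces X (Y :\ e)) = (e \notin S).
  move=> SF; have Si := subsetP (faces_indep _ _) S SF.
  rewrite mem_phi ?faces_indep //; move: SF.
  by rewrite !inE Si subsetD1 /= => /andP[-> ->].
have [x0 x0P' x0Q] : exists2 x, x \in P' & x \notin phi @: faces X (Y :\ e).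
  by apply/subsetPn; apply: contra nQ; rewrite eqEsubset QP' andbT.
have [S0 [x0E S0F _]] := P'F _ x0P'.
pose Pr S := [&& S \in faces X Y, phi S \in P' & e \in S].
have PrS0 : Pr S0 by rewrite /Pr S0F -x0E x0P' /=; move: x0Q; rewrite x0E memQ // negbK.
case: (@arg_minnP _ S0 Pr (fun S => #|S|) PrS0) => S /and3P[SF SP' eS] Smin.
have Si := subsetP (faces_indep _ _) S SF.
have Sei : S :\ e \in indep N by rewrite (indepS (subsetDl _ _) Si).
have SeF : S :\ e \in faces X Y.
  move: SF; rewrite !inE Sei Si /= => /andP[XS SY].
  rewrite (subset_trans (subsetDl _ _) SY) andbT properEneq subsetD1 eX (proper_sub XS).
  (* [S :\ e] is a face: were it [X], then [S] would be [e |: X], which has been taken out. *)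
  rewrite !andbT; apply: contraTneq (SP') => XE; apply/negP => /P'F[S' [/phi_inj e' S'F]].
  rewrite -e' ?(subsetP (faces_indep _ _) S' S'F) //.
  by rewrite XE setD1K ?eqxx.
exists (phi S), (phi (S :\ e)); split.
- by rewrite inE SP' memQ // eS.
- rewrite !inE phi_comparable // subsetDl orbT andbT.
  rewrite (subsetP QP') ?memQ ?setD11 // andbT.
  by apply: contraTneq eS => /phi_inj <- //; rewrite setD11.
move=> z; rewrite !inE => /andP[/andP[zS zP']].
have [S' [zE S'F _]] := P'F _ zP'; rewrite zE in zS zP' *.
have S'i := subsetP (faces_indep _ _) S' S'F.
rewrite !phi_comparable // => /orP[SS'|S'S].
  by rewrite (subset_trans (subsetDl _ _) SS').
rewrite subsetD1 S'S /=; apply/orP; right; apply/negP => eS'.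
have := Smin S'; rewrite /Pr S'F zP' eS' => /(_ isT).
by rewrite leqNgt proper_card // properEneq S'S andbT; apply: contraNneq zS => ->.
Qed.

(** A set [S] avoiding [e] is dominated by [e |: S] when the sets are removed by decreasing size,
    since the proper supersets of [S] still present contain [e]. What remains is a cone with apex
    [e |: X]. *)
Lemma spherical_coloop X Y e d : X \in indep N -> X \subset Y -> e \in Y -> e \notin X ->
  (forall S, S \in indep N -> X \subset S -> S \subset Y -> e |: S \in indep N) ->
  spherical le (phi @: faces X Y) d 0.
Proof.
move=> Xi XY eY eX eI.
pose Q := [set S in faces X Y | e \in S].
have QF : Q \subset faces X Y by rewrite /Q setIdE subsetIl.
have Qi := subset_trans QF (faces_indep X Y).
have eXi : e |: X \in indep N by apply: eI.
apply: (@spherical_retract _ _ le_refl _ (phi @: Q)); first exact: imsetS.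
  move=> P' QP' P'P nQ.
  have P'F x : x \in P' -> exists2 S, S \in faces X Y & x = phi S.
    by move=> /(subsetP P'P)/imsetP[S SF ->]; exists S.
  have memQ S : S \in faces X Y -> (phi S \in phi @: Q) = (e \in S).
    move=> SF; rewrite mem_phi //; last exact: (subsetP (faces_indep _ _) S SF).
    by rewrite inE SF.
  have [x0 x0P' x0Q] : exists2 x, x \in P' & x \notin phi @: Q.
    by apply/subsetPn; apply: contra nQ; rewrite eqEsubset QP' andbT.
  have [S0 S0F x0E] := P'F _ x0P'.
  pose Pr S := [&& S \in faces X Y, phi S \in P' & e \notin S].
  have PrS0 : Pr S0 by rewrite /Pr S0F -x0E x0P' /=; move: x0Q; rewrite x0E memQ.
  case: (@arg_maxnP _ S0 Pr (fun S => #|S|) PrS0) => S /and3P[SF SP' eS] Smax.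
  have := SF; rewrite inE => /and3P[Si XS SY].
  have eSi : e |: S \in indep N by apply: eI => //; apply: proper_sub.
  have eSF : e |: S \in faces X Y.
    by rewrite inE eSi subUset sub1set eY SY andbT (proper_sub_trans XS) ?subsetUr.
  exists (phi S), (phi (e |: S)); split.
  - by rewrite inE SP' memQ // eS.
  - rewrite !inE phi_comparable // subsetUr andbT.
    rewrite (subsetP QP') ?memQ ?setU11 // andbT.
    by apply: contraNneq eS => /phi_inj <- //; rewrite setU11.
  move=> z; rewrite !inE => /andP[/andP[zS zP']].
  have [S' S'F zE] := P'F _ zP'; rewrite zE in zS zP' *.
  have S'i := subsetP (faces_indep _ _) S' S'F.
  rewrite !phi_comparable // => /orP[SS'|S'S]; last first.
    by rewrite (subset_trans S'S) ?subsetUr ?orbT.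
  rewrite subUset sub1set SS' andbT; apply/orP; left; apply: contraT => eS'.
  have : (#|S'| <= #|S|)%N by apply: Smax; rewrite /Pr S'F zP' eS'.
  rewrite leqNgt proper_card // properEneq SS' andbT; apply: contraNneq zS => -> //.
have XeQ : e |: X \in Q.
  rewrite inE setU11 andbT inE eXi subUset sub1set eY XY andbT.
  by rewrite properUr // sub1set.
apply: (@cone_spherical _ _ le_refl _ (phi (e |: X))); first exact: imset_f.
move=> _ /imsetP[S SQ ->]; rewrite phi_comparable ?(subsetP Qi) //.
by move: SQ; rewrite !inE subUset sub1set => /andP[/and3P[_ /proper_sub-> _] ->].
Qed.

Lemma sum_coloop X Y e : e \in Y -> e \notin X ->
  (forall S, S \in indep N -> X \subset S -> S \subset Y -> e |: S \in indep N) ->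
  \sum_(S in indep N | (X \subset S) && (S \subset Y)) (-1) ^+ #|S| = 0 :> int.
Proof.
move=> eY eX eI; apply: (sum_sign_toggle (e := e)) => S eS.
rewrite subUset sub1set eY /=; apply/and3P/and3P => -[Si XS SY]; split=> //.
- exact: indepS (subsetUr _ _) Si.
- apply/subsetP => x xX; have := subsetP XS x xX; rewrite !inE => /orP[/eqP xe|//].
  by move: xX; rewrite xe (negPf eX).
- exact: eI.
- exact: subset_trans XS (subsetUr _ _).
Qed.

(** Deletion and contraction: the vertex [e |: X] has link [faces (e |: X) Y], and the other faces
    retract onto [faces X (Y :\ e)]. The alternating sum splits in the same way, according to
    whether [e] lies in [S]. *)
Lemma spherical_faces X Y : X \in indep N -> X \subset Y ->
  exists2 n : nat,
    n%:Z = (-1) ^+ rk N Y *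
      \sum_(S in indep N | (X \subset S) && (S \subset Y)) (-1) ^+ #|S|
  & spherical le (phi @: faces X Y) ((rk N Y)%:Z - #|X|%:Z - 1) n.
Proof.
have [k] := ubnP #|Y :\: X|; elim: k X Y => // k IHk X Y ltk Xi XY.
have [/existsP[e /and3P[eY eX eXi]]|noe] :=
    boolP [exists e, [&& e \in Y, e \notin X & e |: X \in indep N]]; last first.
  (* Here [X] is a basis of [Y], so there are no faces. *)
  have only S : S \in indep N -> X \subset S -> S \subset Y -> S = X.
    move=> Si XS SY; apply/eqP; rewrite eqEsubset XS andbT; apply/subsetP => x xS.
    apply: contraNT noe => xX; apply/existsP; exists x; rewrite xX (subsetP SY) //=.
    by apply: indepS Si; rewrite subUset sub1set xS.
  have rX : rk N Y = #|X|.
    by have [J [Ji XJ JY <-]] := basis_exists Xi XY; rewrite (only J).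
  exists 1%N.
    rewrite (big_pred1 X) => [|S /=]; first by rewrite rX -exprD addnn -muln2 exprM sqrr_sign.
    apply/idP/eqP => [/and3P[Si XS SY]|->]; first exact: only.
    by rewrite Xi subxx XY.
  have -> : faces X Y = set0.
    apply/setP => S; rewrite !inE; apply/negP => /and3P[Si XS SY].
    by move: (XS); rewrite (only S Si (proper_sub XS) SY) properxx.
  by rewrite imset0 rX subrr sub0r; apply: spherical0.
(* A coloop of [Y] is treated apart: deleting it lowers the rank, and the degrees of deletion and
   link would not match. *)
have [/forallP eI|] := boolP [forall S : {set E},
    [&& S \in indep N, X \subset S & S \subset Y] ==> (e |: S \in indep N)].
  have {}eI S : S \in indep N -> X \subset S -> S \subset Y -> e |: S \in indep N.
    by move=> Si XS SY; have := eI S; rewrite Si XS SY.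
  exists 0%N; first by rewrite (sum_coloop eY eX eI) mulr0.
  exact: spherical_coloop eX eI.
rewrite negb_forall => /existsP[S0]; rewrite negb_imply => /andP[/and3P[S0i XS0 S0Y] eS0].
have eS0' : e \notin S0 by apply: contra eS0 => eS; rewrite (setUidPr _) ?sub1set.
(* A basis of [Y :\ e] containing [S0] cannot be enlarged by [e], so it is a basis of [Y]. *)
have rYe : rk N (Y :\ e) = rk N Y.
  apply/eqP; rewrite eqn_leq rkS ?subsetDl //= leqNgt; apply/negP.
  have [|J [Ji S0J JY cJ]] := basis_exists S0i (_ : S0 \subset Y :\ e).
    by rewrite subsetD1 S0Y.
  have [J' [J'i _ J'Y <-]] := basis_exists (indep0 N) (sub0set Y).
  rewrite -cJ => /(indep_aug Ji J'i)[x /setDP[xJ' xJ] xJi].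
  have [xe|xe] := eqVneq x e.
    by case/negP: eS0; apply: indepS xJi; rewrite xe setUS.
  case/negP: xJ; apply: rk_basis_aug cJ _ xJi JY => //.
  by rewrite !inE xe (subsetP J'Y).
have lt1 : (#|Y :\: (e |: X)| < k)%N.
  rewrite -ltnS; apply: leq_trans ltk; rewrite ltnS.
  rewrite proper_card //; apply/properP; split; first by rewrite setDS ?subsetUr.
  by exists e; rewrite !inE ?eqxx ?eX.
have lt2 : (#|(Y :\ e) :\: X| < k)%N.
  rewrite -ltnS; apply: leq_trans ltk; rewrite ltnS.
  rewrite proper_card //; apply/properP; split; first by rewrite setSD ?subsetDl.
  by exists e; rewrite !inE ?eqxx ?eX.
have [|m em sm] := IHk _ _ lt1 eXi; first by rewrite subUset sub1set eY.
have [|n en sn] := IHk _ _ lt2 Xi; first by rewrite subsetD1 XY.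
exists (n + m)%N.
  rewrite PoszD em en rYe -mulrDr; congr (_ * _).
  rewrite [RHS](bigID (fun S => e \in S)) /= [RHS]addrC; congr (_ + _); apply: eq_bigl => S.
    by rewrite subsetD1 !andbA.
  by rewrite subUset sub1set; case: (e \in S); rewrite ?andbF ?andbT.
have eXF : e |: X \in faces X Y.
  by rewrite inE eXi subUset sub1set eY XY andbT properUr // sub1set.
apply: (@spherical_remove _ _ le_refl _ (phi (e |: X))).
- exact: imset_f.
(* No set lies strictly between [X] and [e |: X], so the other faces comparable with [e |: X] are
   those strictly containing it. *)
- rewrite (_ : neighbours _ _ _ = phi @: faces (e |: X) Y).
    suff -> : (rk N Y)%:Z - #|X|%:Z - 1 - 1 = (rk N Y)%:Z - #|e |: X|%:Z - 1 by [].
    by rewrite cardsU1 eX; lia.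
  apply/setP => z; rewrite !inE; apply/idP/imsetP.
    case/andP=> /andP[zn /imsetP[S SF zE]]; rewrite zE in zn *.
    have := SF; rewrite inE => /and3P[Si XS SY].
    rewrite phi_comparable // => c; exists S => //.
    have nS : S != e |: X by apply: contraNneq zn => ->.
    rewrite inE Si SY andbT properEneq eq_sym nS /=; case/orP: c => // SeX.
    case/negP: nS; rewrite eqEsubset SeX subUset sub1set (proper_sub XS) andbT.
    apply: contraT => eS; case/properP: XS => _ [y yS yX].
    have := subsetP SeX y yS; rewrite !inE (negPf yX) orbF => /eqP ye.
    by rewrite -ye yS in eS.
  case=> S; rewrite inE => /and3P[Si eXS SY] ->.
  rewrite phi_comparable // (proper_sub eXS) andbT; apply/andP; split.
    by apply: contraTneq eXS => /phi_inj -> //; rewrite properxx.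
  apply: imset_f; rewrite inE Si SY andbT.
  exact: sub_proper_trans (subsetUr _ _) eXS.
- by rewrite -rYe; apply: spherical_restrict.
Qed.

End IndependenceComplex.

(** * The Moebius function of the lattice of flats *)

Section MobiusSpanning.
Variable E : finType.
Implicit Types (M W : matroid E) (A F I J S T X Y : {set E}) (e : E).

Lemma circuits1 M e : e \in ground M -> ([set e] \in circuits M) = ([set e] \notin indep M).
Proof.
move=> eE; rewrite inE; apply/minsetP/idP => /= [[/andP[]]//|ne].
split=> [|X /andP[_ nX]]; first by rewrite sub1set eE.
by rewrite subset1 => /predU1P[//|/eqP X0]; rewrite X0 indep0 in nX.
Qed.

Lemma mclosure0 W e : e \in ground W -> (e \in mclosure W set0) = ([set e] \notin indep W).
Proof. by move=> eE; rewrite indep_mclosure ?indep0 // in_set0 setU0. Qed.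

Lemma loopless_mclosure0 W : loopless W -> mclosure W set0 = set0.
Proof.
move=> /forall_inP lW; apply/setP => e; rewrite in_set0; apply/negP => ecl.
have eE := subsetP (mclosure_ground W set0) e ecl.
by have := lW e eE; rewrite circuits1 // negbK; move: ecl; rewrite mclosure0 // => /negP.
Qed.

Lemma mclosure_flat W A : mclosure W A \in flats W.
Proof. by rewrite inE mclosure_ground mclosureK eqxx. Qed.

(** Both sides obey the same recursion: for nonempty [F] the signed sum over all subsets of [F]
    vanishes, and these subsets are grouped by their closures, which are the flats inside [F]. *)
Lemma mobius_flats W F : mclosure W set0 = set0 -> F \in flats W ->
  mobius (flats W) (fun F G : {set E} => F \subset G) set0 F
  = \sum_(A : {set E} | (A \subset F) && (mclosure W A == F)) (-1) ^+ #|A|.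
Proof.
move=> cl0; have [k] := ubnP #|F|; elim: k F => // k IHk F ltk Ff.
rewrite mobiusE //; last 2 first.
- by move=> A B AB; apply/eqP; rewrite eqEsubset.
- by move=> B A C; apply: subset_trans.
case: eqP => [F0|/eqP F0].
  rewrite (big_pred1 set0) ?cards0 // => A /=; rewrite -F0 subset0.
  by apply/andP/eqP => [[/eqP]//|->]; rewrite cl0 eqxx.
apply/esym/eqP; rewrite -addr_eq0 addrC; apply/eqP.
have [e eF] : exists e, e \in F by apply/set0Pn; rewrite eq_sym.
have FE : F \subset ground W by move: Ff; rewrite inE => /andP[].
rewrite -[RHS](@sum_sign_toggle _ (fun A => A \subset F) e); last first.
  by move=> A _; rewrite subUset sub1set eF.
rewrite [RHS](partition_big (mclosure W) (fun G => (G \in flats W) && (G \subset F))) /=.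
  rewrite [RHS](bigD1 F) /=; last by rewrite Ff subxx.
  rewrite addrC; congr (_ + _).
  apply: eq_big => G; first by rewrite sub0set /= andbA.
  rewrite sub0set /= => /and3P[Gf GF nG]; rewrite IHk //; last first.
    by rewrite -ltnS; apply: leq_trans ltk; rewrite ltnS proper_card // properEneq nG.
  apply: eq_bigl => A; apply/andP/andP => [[AG ->]|[AF /eqP <-]]; split=> //.
    exact: subset_trans AG GF.
  by apply: sub_mclosure; apply: subset_trans AF FE.
move=> A AF; rewrite mclosure_flat /=.
by move: Ff; rewrite inE => /andP[_ /eqP <-]; apply: mclosureS.
Qed.

(** Toggling a loop preserves spanning, so with a loop the sum vanishes, in agreement with the
    convention for the reduced Moebius function. *)
Lemma reduced_mobiusE W : reduced_mobius W =
  absz (\sum_(A : {set E} | (A \subset ground W) && (mclosure W A == ground W))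
    (-1) ^+ #|A| : int).
Proof.
rewrite /reduced_mobius; case: ifPn => [lW|].
  have cl0 := loopless_mclosure0 lW; rewrite cl0 mobius_flats //.
  rewrite inE subxx; apply/eqP/eqP; rewrite eqEsubset mclosure_ground.
  exact: sub_mclosure.
rewrite negb_forall => /existsP[e]; rewrite negb_imply negbK => /andP[eE].
rewrite circuits1 // -mclosure0 // => ecl.
rewrite (@sum_sign_toggle _ _ e) // => A _; rewrite subUset sub1set eE /=.
have [AE|//] := boolP (A \subset ground W); congr (_ == _).
apply/eqP; rewrite eqEsubset [X in _ && X]mclosureS ?subsetUr // andbT.
apply: mclosure_sub; rewrite subUset sub_mclosure // andbT sub1set.
by apply: subsetP ecl; apply: mclosureS; apply: sub0set.
Qed.

Lemma mclosure_full W A : A \subset ground W ->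
  (mclosure W A == ground W) = (rk W A == rk W (ground W)).
Proof.
move=> AE; apply/eqP/eqP => [e|e].
  have [J [Ji _ JA cJ]] := basis_exists (indep0 W) (sub0set A).
  by have [_] := basis_mclosure Ji JA cJ; rewrite e cJ.
apply/eqP; rewrite eqEsubset mclosure_ground; apply/subsetP => x xE.
rewrite inE xE eqn_leq (rkS _ (subsetUr [set x] A)) andbT e rkS //.
by rewrite subUset sub1set xE.
Qed.

Lemma restrict_bases M X Y :
  (Y \in bases (restrict M X)) = [&& Y \in indep M, Y \subset X & #|Y| == rk M X].
Proof.
apply/basesP/and3P => /= [[]|[Yi YX /eqP cY]].
  rewrite inE => /andP[Yi YX] Ymax; split=> //; rewrite eqn_leq leq_rk //=.
  have [J [Ji _ JX <-]] := basis_exists (indep0 M) (sub0set X).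
  by apply: Ymax; rewrite inE Ji.
split; first by rewrite inE Yi.
by move=> I; rewrite inE cY => /andP[Ii IX]; apply: leq_rk.
Qed.

(** A maximal independent subset of [A :|: X] can be chosen as a basis of [X] together with an
    independent set of the contraction. *)
Lemma rk_contract M X A : A \subset ground M :\: X ->
  (rk (contract M X) A + rk M X)%N = rk M (A :|: X).
Proof.
move=> AE; have dis I Y : I \subset A -> Y \subset X -> #|I :|: Y| = (#|I| + #|Y|)%N.
  move=> IA YX; rewrite cardsU disjoint_setI0 ?cards0 ?subn0 //.
  apply: disjointWr YX _; apply: disjointWl (subset_trans IA AE) _.
  by rewrite disjoint_sym disjoints_subset setCD subsetUr.
apply/eqP; rewrite eqn_leq; apply/andP; split.
  have [I [Ii _ IA <-]] := basis_exists (indep0 (contract M X)) (sub0set A).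
  move: Ii; rewrite inE => /andP[_ /existsP[Y]].
  rewrite restrict_bases => /andP[/and3P[Yi YX /eqP <-] IYi].
  by rewrite -dis // leq_rk // setUSS.
have [Y [Yi _ YX cY]] := basis_exists (indep0 M) (sub0set X).
have [J [Ji YJ JAX <-]] := basis_exists Yi (subset_trans YX (subsetUr A X)).
have IA : J :\: Y \subset A.
  apply/subsetP => x /setDP[xJ xY]; have /setUP[//|xX] := subsetP JAX x xJ.
  case/negP: xY; apply: rk_basis_aug cY xX _ YX => //.
  by apply: indepS Ji; rewrite subUset sub1set xJ.
rewrite -(setID J Y) (setIidPr YJ) setUC dis // cY leq_add2r leq_rk //.
rewrite inE (subset_trans IA AE); apply/existsP; exists Y.
by rewrite restrict_bases Yi YX cY eqxx /= setUC -{1}(setIidPr YJ) setID.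
Qed.

Lemma bases_rk M B : (B \in bases M) = (B \in indep M) && (#|B| == rk M (ground M)).
Proof.
apply/basesP/andP => [[Bi Bmax]|[Bi /eqP cB]]; split=> //.
  rewrite eqn_leq leq_rk ?indep_ground //=.
  by have [J [Ji _ _ <-]] := basis_exists (indep0 M) (sub0set (ground M)); apply: Bmax.
by move=> I Ii; rewrite cB leq_rk ?indep_ground.
Qed.

Lemma dual_indep_rk M S :
  (S \in indep (dual M))
  = (S \subset ground M) && (rk M (ground M :\: S) == rk M (ground M)).
Proof.
rewrite inE; have [SE /=|//] := boolP (S \subset ground M).
apply/existsP/eqP => [[B /andP[]]|e].
  rewrite bases_rk => /andP[Bi /eqP cB] SB; apply/eqP.
  rewrite eqn_leq rkS ?subsetDl //= -cB leq_rk // subsetD indep_ground //.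
  by rewrite disjoint_sym.
have [J [Ji _ JE cJ]] := basis_exists (indep0 M) (sub0set (ground M :\: S)).
exists J; rewrite bases_rk Ji cJ e eqxx disjoint_sym.
by move: JE; rewrite subsetD => /andP[].
Qed.

(** Both conditions say that [A] together with the contracted elements has full rank in [M]. *)
Lemma contract_to_spanning M T A : T \subset ground M -> A \subset T ->
  (mclosure (contract_to M T) A == ground (contract_to M T))
  = (T :\: A \in indep (dual M)).
Proof.
move=> TE AT; have gW : ground (contract_to M T) = T.
  by rewrite /= setDDr setDv set0U (setIidPr TE).
rewrite mclosure_full ?gW // dual_indep_rk (subset_trans (subsetDl _ _) TE) /=.
rewrite -(eqn_add2r (rk M (ground M :\: T))) !rk_contract;
  try by rewrite setDDr setDv set0U (setIidPr TE).
have e X : X \subset T -> X :|: ground M :\: T = ground M :\: (T :\: X).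
  by move=> XT; rewrite setDDr (setIidPr (subset_trans XT TE)) setUC.
by rewrite !e // setDv setD0.
Qed.

(** Complementation in [T] multiplies every sign by [(-1) ^+ #|T|], which the absolute value
    absorbs. *)
Lemma reduced_mobius_contract_to M T : T \subset ground M ->
  reduced_mobius (contract_to M T) =
  absz (\sum_(S in indep (restrict (dual M) T)) (-1) ^+ #|S| : int).
Proof.
move=> TE; have gW : ground (contract_to M T) = T.
  by rewrite /= setDDr setDv set0U (setIidPr TE).
rewrite reduced_mobiusE -[RHS](abszMsign #|T|); congr absz.
rewrite (eq_bigl (fun A => (A \subset T) && (T :\: A \in indep (dual M)))) => [|A].
  rewrite (reindex_onto (fun S => T :\: S) (fun A => T :\: A)); last first.
    by move=> A /andP[AT _]; rewrite setDDr setDv set0U (setIidPr AT).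
  rewrite mulr_sumr; apply: eq_big => S.
    rewrite subsetDl setDDr setDv set0U [RHS]inE.
    have [ST|ST] := boolP (S \subset T); first by rewrite (setIidPr ST) eqxx.
    rewrite !andbF; apply/negP => /andP[_ /eqP e].
    by case/negP: ST; rewrite -e subsetIl.
  move=> /andP[_ /eqP]; rewrite setDDr setDv set0U => /setIidPr ST.
  by rewrite -[in RHS](cardsID S T) (setIidPr ST) exprD mulrAC -mulrA signrMK.
rewrite [in LHS]gW; have [AT|//] := boolP (A \subset T).
by rewrite -contract_to_spanning // gW.
Qed.

End MobiusSpanning.

(** * The external order *)

Section ConvexGeometry.
Variables (disp : Order.disp_t) (E : finOrderType disp) (M : matroid E).
Implicit Types (A B C F G I J S X : {set E}) (e x : E).

Definition above F e := [set f in F | (e < f)%O].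

Definition ext_closure F := F :|: Act M F.

(* The basis of [X] that the greedy algorithm builds from the largest element down. *)
Definition last_basis X := X :\: Act M X.

Lemma aboveS F G e : F \subset G -> above F e \subset above G e.
Proof. by move=> FG; rewrite /above !setIdE setSI. Qed.

Lemma sub_above F e : above F e \subset F.
Proof. by rewrite /above setIdE subsetIl. Qed.

(** A circuit with minimum [e] is [e] together with an independent set of larger elements spanning
    it. Activity thereby becomes a statement about closures. *)
Lemma mem_Act F e : (e \in Act M F) = (e \in mclosure M (above F e)).
Proof.
apply/idP/idP => [eA|ecl].
  have eE := Act_ground eA.
  move: eA; rewrite inE => /existsP[C /and4P[Cc CF eC /forall_inP Cmin]].
  move: Cc; rewrite inE => /minsetP[/= /andP[CE Cd] minC].
  have Ci : C :\ e \in indep M.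
    apply: contraT => nC; have := minC (C :\ e).
    rewrite nC (subset_trans (subsetDl _ _) CE) subsetDl => /(_ isT isT)/setP/(_ e).
    by rewrite setD11 eC.
  suff /mclosureS/subsetP : C :\ e \subset above F e.
    by apply; rewrite indep_mclosure // setD1K // Cd orbT.
  apply/subsetP => x /setD1P[xe xC]; rewrite inE lt_neqAle eq_sym xe Cmin //.
  by have := subsetP CF x xC; rewrite !inE (negPf xe) !andbT.
have eE := subsetP (mclosure_ground M _) e ecl.
have [J [Ji _ JF cJ]] := basis_exists (indep0 M) (sub0set (above F e)).
have Jgt x : x \in J -> (e < x)%O by move/(subsetP JF); rewrite inE => /andP[].
move: ecl; rewrite (mclosure_basis Ji) // => /orP[/Jgt|eJ]; first by rewrite ltxx.
have [|C Cc CJ] := circuit_exists _ eJ.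
  by rewrite subUset sub1set eE indep_ground.
rewrite inE; apply/existsP; exists C; rewrite Cc /=; apply/and3P; split.
- exact: subset_trans CJ (setUS _ (subset_trans JF (sub_above F e))).
- move: Cc; rewrite inE => /minsetp/andP[_]; apply: contraR => eC.
  apply: indepS Ji; apply/subsetP => x xC.
  by have /setU1P[xe|//] := subsetP CJ x xC; rewrite -xe xC in eC.
- by apply/forall_inP => x /(subsetP CJ)/setU1P[->//|/Jgt/ltW].
Qed.

Lemma Act_sub_ground F : Act M F \subset ground M.
Proof. by apply/subsetP => e /Act_ground. Qed.

Lemma ActS F G : F \subset G -> Act M F \subset Act M G.
Proof.
by move=> FG; apply/subsetP => e; rewrite !mem_Act; apply/subsetP/mclosureS/aboveS.
Qed.

Lemma sub_ext_closure F : F \subset ext_closure F.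
Proof. exact: subsetUl. Qed.

Lemma ext_closure_ground F : F \subset ground M -> ext_closure F \subset ground M.
Proof. by move=> FE; rewrite subUset FE Act_sub_ground. Qed.

(** An active [x] above [e] is spanned by elements of [F] above [x], hence above [e]. *)
Lemma above_ext_closure F e : F \subset ground M ->
  above (ext_closure F) e \subset mclosure M (above F e).
Proof.
move=> FE; apply/subsetP => x; rewrite inE in_setU => /andP[/orP[xF|xA] ex].
  apply: (subsetP (sub_mclosure (subset_trans (sub_above F e) FE))).
  by rewrite inE xF.
rewrite mem_Act in xA; apply: (subsetP (mclosureS _ _)) xA.
by apply/subsetP => y; rewrite !inE => /andP[-> /(lt_trans ex)].
Qed.

Lemma ext_closure_sub F G : G \subset ground M ->
  F \subset ext_closure G -> ext_closure F \subset ext_closure G.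
Proof.
move=> GE FG; rewrite subUset FG; apply/subsetP => e; rewrite mem_Act => eF.
apply/setUP; right; rewrite mem_Act.
apply: (subsetP (mclosure_sub (above_ext_closure e GE))).
exact: (subsetP (mclosureS _ (aboveS e FG))).
Qed.

(** The elements of [I] are the extreme points of its closure: passing to the closure does not
    change activity, and no element of an independent set is spanned by the larger ones. *)
Lemma mem_indep_ext_closure I e : I \in indep M ->
  (e \in I) = (e \in ext_closure I) && (e \notin Act M (ext_closure I)).
Proof.
move=> Ii; have IE := indep_ground Ii.
have -> : (e \in Act M (ext_closure I)) = (e \in Act M I).
  apply/idP/idP; last exact/subsetP/ActS/sub_ext_closure.
  by rewrite !mem_Act => /(subsetP (mclosure_sub (above_ext_closure e IE))).
rewrite in_setU; have [eA|eA] := boolP (e \in Act M I); last by rewrite orbF andbT.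
rewrite andbF; apply/negP => eI; move: eA.
have Ai : above I e \in indep M := indepS (sub_above I e) Ii.
rewrite mem_Act indep_mclosure ?(subsetP IE) // inE ltxx andbF /=.
by rewrite (indepS _ Ii) // subUset sub1set eI sub_above.
Qed.

Lemma ext_closure_inj : {in indep M &, injective ext_closure}.
Proof.
move=> I J Ii Ji e; apply/setP => x.
by rewrite (mem_indep_ext_closure x Ii) (mem_indep_ext_closure x Ji) e.
Qed.

(** The minimum of a circuit inside [last_basis X] would be active in [X], hence discarded. *)
Lemma last_basis_indep X : X \subset ground M -> last_basis X \in indep M.
Proof.
move=> XE; apply: contraT => /(circuit_exists (subset_trans (subsetDl _ _) XE))[C Cc CX].
have [C0|[c cC]] := set_0Vmem C.
  by move: Cc; rewrite C0 inE => /minsetp; rewrite /= indep0 andbF.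
case: (@Order.TotalTheory.arg_minP _ _ _ c (fun x => x \in C) id cC) => m mC minm.
have /setDP[_ /negP[]] := subsetP CX m mC.
rewrite inE; apply/existsP; exists C; rewrite Cc mC /=.
rewrite (subset_trans CX) ?(subset_trans (subsetDl _ _)) ?subsetUr //=.
exact/forall_inP.
Qed.

(** Induction from the largest element down: a discarded [x] is spanned by the elements of [X] above
    it, and these already lie in the closure of [last_basis X]. *)
Lemma sub_ext_closure_last_basis X : X \subset ground M ->
  X \subset ext_closure (last_basis X).
Proof.
move=> XE; apply/subsetP => x.
have [k] := ubnP #|[set y | (x < y)%O]|; elim: k x => // k IHk x ltk xX.
have [xB|xB] := boolP (x \in last_basis X); first by rewrite inE xB.
have xA : x \in Act M X by apply: contraR xB => xA; apply/setDP.
rewrite in_setU mem_Act; apply/orP; right.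
rewrite mem_Act in xA; apply: (subsetP (mclosure_sub _)) xA.
apply: subset_trans (above_ext_closure x (subset_trans (subsetDl _ _) XE)).
apply/subsetP => f; rewrite [in X in X -> _]inE => /andP[fX xf].
rewrite inE xf andbT; apply: IHk fX; rewrite -ltnS; apply: leq_trans ltk.
rewrite ltnS proper_card //; apply/properP; split.
  by apply/subsetP => y; rewrite !inE; apply: lt_trans.
by exists f; rewrite !inE ?ltxx.
Qed.

Lemma ext_closure_mclosure F : F \subset ground M -> ext_closure F \subset mclosure M F.
Proof.
move=> FE; rewrite subUset sub_mclosure //=; apply/subsetP => e.
by rewrite mem_Act; apply: (subsetP (mclosureS _ (sub_above _ _))).
Qed.

Lemma last_basis_bases X : X \subset ground M -> rk M X = rk M (ground M) ->
  last_basis X \in bases M.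
Proof.
move=> XE rX; have Bi := last_basis_indep XE; have BE := indep_ground Bi.
rewrite bases_rk Bi eqn_leq leq_rk //= -rX.
have [_ ->] := basis_mclosure Bi (subxx _) (esym (rk_indep Bi)).
apply: rkS; apply: subset_trans (sub_ext_closure_last_basis XE) _.
exact: ext_closure_mclosure.
Qed.

(** Activity is monotone, so an element inactive in the whole ground set is never added by a
    closure. *)
Lemma notin_ext_closure_last_basis X e : X \subset ground M ->
  e \notin Act M (ground M) -> e \notin X -> e \notin ext_closure (last_basis X).
Proof.
move=> XE eA eX; rewrite in_setU negb_or; apply/andP; split.
  by apply: contra eX => /setDP[].
by apply: contra eA; apply/subsetP/ActS; apply: subset_trans (subsetDl _ _) XE.
Qed.

Lemma ext_leE A B : ext_le M (Some A) (Some B) = (A \subset ext_closure B).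
Proof.
by rewrite /= (_ : B :|: _ = ext_closure B) // /ext_closure /Ext setDE setUIr setUCr setIT.
Qed.

Lemma ext_le_closure A B : A \in bases M -> B \in bases M ->
  ext_le M (Some A) (Some B) = (ext_closure A \subset ext_closure B).
Proof.
move=> _; rewrite bases_rk ext_leE => /andP[/indep_ground BE _].
apply/idP/idP; first exact: ext_closure_sub.
exact: subset_trans (sub_ext_closure A).
Qed.

Lemma ext_le_refl : reflexive (ext_le M).
Proof. by case=> // A; rewrite /ext_le subsetUl. Qed.

(** By [ext_closure_inj] the order is antisymmetric on bases, so the maximum found in
    [max_base_exists] is the only one. *)
Lemma max_baseE T : max_base M T -> T = last_basis (ground M).
Proof.
case=> Tin Tmax; have [T0in T0max] := max_base_exists M.
have inbase B : Some B \in ext_lattice M -> B \in bases M.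
  by case/setU1P => // /imsetP[B' B'b [->]].
have Tb := inbase _ Tin; have T0b := inbase _ T0in.
move: (Tmax _ T0in) (T0max _ Tin); rewrite !ext_le_closure // => le1 le2.
apply: ext_closure_inj.
- by move: Tb; rewrite bases_rk => /andP[].
- by move: T0b; rewrite bases_rk => /andP[].
by apply/eqP; rewrite eqEsubset le2.
Qed.

End ConvexGeometry.

(** * Reduction to the meets of coatoms *)

Section Crosscut.
Variables (disp : Order.disp_t) (E : finOrderType disp) (M : matroid E).
Variable T : {set E}.
Hypothesis maxT : max_base M T.
Implicit Types (A B S : {set E}).

Local Notation N := (restrict (dual M) T).

(** For [S] independent in [N], the base with closure [ground M :\: S], that is, the meet of the
    coatoms omitting one element of [S]. *)
Definition coatom_meet S : option {set E} := Some (last_basis M (ground M :\: S)).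

Lemma T_bases : T \in bases M.
Proof. by case: maxT => + _; case/setU1P => // /imsetP[B Bb [->]]. Qed.

Lemma T_ground : T \subset ground M.
Proof. by apply: indep_ground; have := T_bases; rewrite bases_rk => /andP[]. Qed.

Lemma N_indep S : (S \in indep N) =
  (S \subset T) && (rk M (ground M :\: S) == rk M (ground M)).
Proof.
rewrite [LHS]inE dual_indep_rk andbC; have [ST|//] := boolP (S \subset T).
by rewrite (subset_trans ST T_ground).
Qed.

Lemma coatom_meet_bases S : S \in indep N -> last_basis M (ground M :\: S) \in bases M.
Proof.
by rewrite N_indep => /andP[_ /eqP rS]; apply: last_basis_bases; rewrite ?subsetDl.
Qed.

Lemma coatom_meet_closure S : S \in indep N ->
  ext_closure M (last_basis M (ground M :\: S)) = ground M :\: S.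
Proof.
rewrite N_indep => /andP[ST _]; have XE := subsetDl (ground M) S.
apply/eqP; rewrite eqEsubset sub_ext_closure_last_basis // andbT subsetD.
rewrite ext_closure_ground ?(subset_trans (subsetDl _ _) XE) //=.
rewrite disjoint_sym disjoints_subset; apply/subsetP => e eS; rewrite inE.
have := subsetP ST e eS; rewrite (max_baseE maxT) => /setDP[_ eA].
by apply: notin_ext_closure_last_basis => //; rewrite inE eS.
Qed.

Lemma coatom_meet_le : {in indep N &, forall S S',
  ext_le M (coatom_meet S) (coatom_meet S') = (S' \subset S)}.
Proof.
move=> S S' Si S'i; rewrite ext_le_closure ?coatom_meet_bases // !coatom_meet_closure //.
move: S'i; rewrite N_indep => /andP[S'T _]; apply/idP/idP => [le|S'S]; last exact: setDS.
apply/subsetP => e eS'; have eE := subsetP T_ground e (subsetP S'T e eS').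
by apply: contraT => eS; have := subsetP le e; rewrite !inE eS eE eS' => /(_ isT).
Qed.

Lemma spherical_crosscut d n :
  spherical (ext_le M) (coatom_meet @: faces N set0 (ground N)) d n ->
  spherical (ext_le M) (ext_lattice M :\: [set None; Some T]) d n.
Proof.
set Q := coatom_meet @: _; set P := _ :\: _.
have P_bases x : x \in P -> exists B, [/\ x = Some B, B \in bases M & B != T].
  case/setDP=> /setU1P[->|/imsetP[B Bb ->]]; first by rewrite !inE.
  by rewrite !inE => BT; exists B; split=> //; apply: contraNneq BT => ->.
have indepT B : B \in bases M -> B \in indep M by rewrite bases_rk => /andP[].
have tauE B : B \in bases M -> ext_closure M B \subset ground M.
  by move=> /indepT/indep_ground/ext_closure_ground.
apply: (spherical_retract (@ext_le_refl _ _ M)).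
  apply/subsetP => _ /imsetP[S SF ->].
  have Si := subsetP (faces_indep _ _ _) S SF.
  have Sb : coatom_meet S \in [set Some B | B in bases M].
    exact: imset_f (coatom_meet_bases Si).
  apply/setDP; split; first exact: setU1r.
  apply/set2P => -[//|[eT]].
  (* The closure of [T] is the whole ground set, so a meet equal to [T] would have [S] empty. *)
  have : ground M \subset ground M :\: S.
    rewrite -(coatom_meet_closure Si) eT (max_baseE maxT).
    exact: sub_ext_closure_last_basis.
  rewrite subsetD subxx /= => /disjoint_setI0 S0.
  have SE : S \subset ground M.
    by move: Si; rewrite N_indep => /andP[ST _]; apply: subset_trans ST T_ground.
  move: SF; rewrite inE => /and3P[_ /proper_card + _].
  by rewrite -(setIidPr SE) S0 ltnn.
move=> P' QP' P'P nQ.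
have [x0 x0P' x0Q] : exists2 x, x \in P' & x \notin Q.
  by apply/subsetPn; apply: contra nQ; rewrite eqEsubset QP' andbT.
have [B0 [x0E B0b _]] := P_bases _ (subsetP P'P _ x0P').
pose Pr B := Some B \in P' :\: Q.
have PrB0 : Pr B0 by rewrite /Pr -x0E inE x0Q.
case: (@arg_maxnP _ B0 Pr (fun B => #|ext_closure M B|) PrB0) => B PrB Bmax.
have /setDP[BP' BQ] := PrB.
have [_ [[<-] Bb BT]] := P_bases _ (subsetP P'P _ BP').
(* The coatoms above [B] are those omitting an element of this set; their meet dominates [B]. *)
pose S := T :\: ext_closure M B.
have ST : S \subset T := subsetDl _ _.
have tauS : ext_closure M B \subset ground M :\: S.
  rewrite subsetD tauE // disjoint_sym disjoints_subset.
  by apply/subsetP => e; rewrite in_setC => /setDP[].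
have Si : S \in indep N.
  rewrite N_indep ST eqn_leq rkS ?subsetDl //=.
  move: Bb; rewrite bases_rk => /andP[Bi /eqP <-]; apply: leq_rk => //.
  exact: subset_trans (sub_ext_closure M B) tauS.
(* A base whose closure contains [T] is the maximum, and [B] is not. *)
have S0 : S != set0.
  rewrite setD_eq0; apply: contraNN BT => TB.
  have := maxT.2 (Some B); rewrite in_setU1 imset_f ?orbT // => /(_ isT).
  have [Bi Ti] := (indepT _ Bb, indepT _ T_bases).
  rewrite ext_le_closure ?T_bases // => leBT.
  apply/eqP/(ext_closure_inj Bi Ti)/eqP; rewrite eqEsubset leBT.
  exact: ext_closure_sub (indep_ground Bi) TB.
have SF : S \in faces N set0 (ground N).
  by rewrite inE Si proper0 S0 indep_ground.
have yQ : coatom_meet S \in Q by apply: imset_f.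
exists (Some B), (coatom_meet S); split=> //.
  rewrite inE in_setD1 (subsetP QP') // andbT; apply/andP; split.
    by apply: contraNneq BQ => <-.
  rewrite /comparable ext_leE coatom_meet_closure //.
  by rewrite (subset_trans (sub_ext_closure M B) tauS).
move=> z; rewrite inE in_setD1 => /andP[/andP[zB zP']].
have [A [zE Ab _]] := P_bases _ (subsetP P'P _ zP'); rewrite zE in zB zP' *.
rewrite [comparable _ _ _]/orb !ext_le_closure //.
case: ifP => [BA _|_ AB].
  (* Above [B], the choice of [B] with largest closure outside [Q] puts [A] in [Q]; it is then the
     meet for some [S'] inside [S]. *)
  have /imsetP[S' S'F AS'] : Some A \in Q.
    apply: contraT => AQ; have : (#|ext_closure M A| <= #|ext_closure M B|)%N.
      by apply: Bmax; rewrite /Pr inE AQ.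
    rewrite leqNgt proper_card // properEneq BA andbT.
    by apply: contraNneq zB => /(ext_closure_inj (indepT _ Bb) (indepT _ Ab))->.
  have S'i := subsetP (faces_indep _ _ _) S' S'F.
  rewrite AS' /comparable coatom_meet_le //; apply/orP; left.
  have tauA : ext_closure M A = ground M :\: S'.
    by case: AS' => ->; apply: coatom_meet_closure.
  have S'T : S' \subset T by move: S'i; rewrite N_indep => /andP[].
  by rewrite subsetD S'T; move: BA; rewrite tauA subsetD disjoint_sym => /andP[].
apply/orP; right; rewrite ext_leE coatom_meet_closure //.
exact: subset_trans (subset_trans (sub_ext_closure M A) AB) tauS.
Qed.

End Crosscut.

Theorem theorem5p2 (disp : Order.disp_t) (E : finOrderType disp)
    (M : matroid E) (T : {set E}) (maxT : max_base M T) (i : int) :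
  let r_star := mrank (restrict (dual M) T) in
  zmod_isomorphic (reduced_homology (Delta M T) i)
    'rV[int]_(if i == r_star%:Z - 1
              then reduced_mobius (contract_to M T) else 0%N).
Proof.
move=> r_star; apply: free_homology_isomorphic.
have [n en sn] := spherical_faces (@ext_le_refl _ _ M) (coatom_meet_le maxT)
  (indep0 _) (sub0set (ground (restrict (dual M) T))).
suff -> : reduced_mobius (contract_to M T) = n.
  by move: i; apply: spherical_crosscut; rewrite // cards0 subr0 in sn.
(* Being a natural number, [n] is its own absolute value, which removes the sign in [en]. *)
rewrite reduced_mobius_contract_to ?T_ground // -[n]/(absz n%:Z) en abszMsign.
congr absz; apply: eq_bigl => S; rewrite sub0set.
by apply/idP/andP => [Si|[]//]; split=> //; apply: indep_ground Si.
Qed.
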